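(* Let $K$ be a field of characteristic $p$, and let $(\lambda,\mu)\in\Lambda_{a,b}$. The permutation module $M^{\lambda,\mu}$ of $K\mathfrak S_{a,b}$ decomposes into a direct sum of indecomposable Young modules, as follows. (1) The indecomposable summands are of the form $Y^{\lambda',\mu'}:=Y^{\lambda'}\boxtimes Y^{\mu'}$ with $(\lambda',\mu')\in\Lambda_{a,b}$, $\lambda'\unrhd\lambda$, $\mu'\unrhd\mu$. (2) $Y^{\lambda,\mu}$ appears exactly once, and the multiplicity of $Y^{\lambda',\mu'}$ in $M^{\lambda,\mu}$, denoted $a_{\lambda',\mu'}:=[M^{\lambda,\mu}:Y^{\lambda',\mu'}]$, is a non-negative integer. (3) For $(\lambda,\mu),(\lambda',\mu')\in\Lambda_{a,b}$, the Young modules $Y^{\lambda',\mu'}$ and $Y^{\lambda,\mu}$ are isomorphic if and only if $\lambda'=\lambda$ and $\mu'=\mu$. Together, $$M^{\lambda,\mu}\cong Y^{\lambda,\mu}\oplus\Big(\bigoplus_{\substack{\lambda'\unrhd\lambda,\ \mu'\unrhd\mu\\(\lambda',\mu')\ne(\lambda,\mu)}}(Y^{\lambda',\mu'})^{\oplus a_{\lambda',\mu'}}\Big).$$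
   Context: Modules are finite-dimensional right modules. $\mathfrak S_a$ is the symmetric group and $\mathfrak S_{a,b}=\mathfrak S_a\times\mathfrak S_b$. $\Lambda_{a,b}$ is the set of pairs $(\lambda,\mu)$ with $\lambda$ a partition of $a$ and $\mu$ a partition of $b$; $\unrhd$ is the dominance order on partitions. For $\lambda\vdash a$, $M^\lambda$ is the $K\mathfrak S_a$-module with basis the $\lambda$-tabloids (the permutation module induced from the trivial module of the Young subgroup $\mathfrak S_\lambda$). The Specht module $S^\lambda\subseteq M^\lambda$ is generated by a polytabloid $\{\mathfrak t\}\cdot\sum_{\sigma\in C_{\mathfrak t}}(\operatorname{sgn}\sigma)\sigma$, with $C_{\mathfrak t}$ the column stabilizer of the $\lambda$-tableau $\mathfrak t$. The Young module $Y^\lambda$ is the (unique up to isomorphism) indecomposable direct summand of $M^\lambda$ containing $S^\lambda$. $M^{\lambda,\mu}=M^\lambda\boxtimes_KM^\mu$ is the outer tensor product. $[M:Y]$ denotes the number of summands isomorphic to the indecomposable module $Y$ in a decomposition of $M$ into indecomposables. *)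

(* Defs.v *)
From HB Require Import structures.
From mathcomp Require Import all_boot all_order all_algebra all_fingroup.
From mathcomp Require Import all_solvable all_field all_character.
From mathcomp Require Import boolp.

Set Implicit Arguments.
Unset Strict Implicit.
Unset Printing Implicit Defensive.

Import GRing.Theory.
Local Open Scope ring_scope.

(* The characteristic of K is p, where p is 0 or a prime number: n is zero in *)
(* K exactly when p divides n (only 0 is divisible by 0).                     *)
Definition has_char (K : fieldType) (p : nat) : Prop :=
  forall n : nat, (n%:R == 0 :> K) = (p %| n)%N.

Section Partitions.

Variable n : nat.

(* Parts are listed in weakly decreasing order and padded with zeros to       *)
(* length n, so each partition of n is represented exactly once.              *)
Definition is_intpart (l : {ffun 'I_n -> 'I_n.+1}) : bool :=
  [forall i : 'I_n, forall j : 'I_n, (i <= j)%N ==> (l j <= l i)%N]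
  && (\sum_i (l i : nat) == n)%N.

Record intpart := IntPart {
  parts :> {ffun 'I_n -> 'I_n.+1};
  intpartP : is_intpart parts
}.

HB.instance Definition _ := [isSub for parts].
HB.instance Definition _ := [Finite of intpart by <:].

Definition dominates (l m : intpart) : bool :=
  [forall k : 'I_n.+1,
     \sum_(i < n | (i < k)%N) m i <= \sum_(i < n | (i < k)%N) l i]%N.

End Partitions.

Section Tableaux.

Variables (n : nat) (lam : intpart n).

(* The Young diagram: Tagged _ (j : 'I_(lam i)) is the cell in row i and      *)
(* column j.                                                                  *)
Definition cell : finType := {i : 'I_n & 'I_(lam i)}.

Definition row_of (c : cell) : nat := tag c.

Definition col_of (c : cell) : nat := tagged c.

Lemma card_cell : #|cell| = n.
Proof.
rewrite card_tagged sumnE big_map big_enum /=.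
under eq_bigr do rewrite card_ord.
by have /andP[_ /eqP] := intpartP lam.
Qed.

(* Injective fillings are bijective by card_cell.                             *)
Record tableau := Tableau {
  entry :> {ffun cell -> 'I_n};
  entryP : injectiveb entry
}.

HB.instance Definition _ := [isSub for entry].
HB.instance Definition _ := [Finite of tableau by <:].

Definition row_set (t : tableau) (i : nat) : {set 'I_n} :=
  [set t c | c in [pred c : cell | row_of c == i]].

Definition col_set (t : tableau) (j : nat) : {set 'I_n} :=
  [set t c | c in [pred c : cell | col_of c == j]].

Definition row_equiv (t u : tableau) : bool :=
  [forall i : 'I_n, row_set t i == row_set u i].

Definition col_stab (t : tableau) : {set 'S_n} :=
  [set s : 'S_n | [forall j : 'I_n, s @: col_set t j == col_set t j]].

Fact tab_act_subproof (t : tableau) (s : 'S_n) :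
  injectiveb [ffun c => s (t c)].
Proof.
apply/injectiveP => c d; rewrite !ffunE => /perm_inj.
exact: (injectiveP _ (entryP t)).
Qed.

(* Permutations compose from left to right, so this is a right action.        *)
Definition tab_act (t : tableau) (s : 'S_n) : tableau :=
  Tableau (tab_act_subproof t s).

Lemma tab_act1 t : tab_act t 1 = t.
Proof. by apply/val_inj/ffunP => c; rewrite ffunE perm1. Qed.

Lemma tab_actM t s1 s2 : tab_act t (s1 * s2)%g = tab_act (tab_act t s1) s2.
Proof. by apply/val_inj/ffunP => c; rewrite !ffunE permM. Qed.

Lemma row_set_act t s i : row_set (tab_act t s) i = s @: row_set t i.
Proof.
by rewrite /row_set -imset_comp; apply: eq_imset => c; rewrite /= ffunE.
Qed.

Lemma row_equiv_act s t u : row_equiv (tab_act t s) (tab_act u s) = row_equiv t u.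
Proof.
apply: eq_forallb => i; rewrite !row_set_act.
by rewrite (inj_eq (imset_inj (@perm_inj _ s))).
Qed.

Definition tabloids : {set {set tableau}} :=
  equivalence_partition row_equiv [set: tableau].

Record tabloid := Tabloid {
  tabloid_set :> {set tableau};
  tabloidP : tabloid_set \in tabloids
}.

HB.instance Definition _ := [isSub for tabloid_set].
HB.instance Definition _ := [Finite of tabloid by <:].

Fact tabloid_of_subproof (t : tableau) :
  [set u in [set: tableau] | row_equiv t u] \in tabloids.
Proof. exact: imset_f. Qed.

Definition tabloid_of (t : tableau) : tabloid := Tabloid (tabloid_of_subproof t).

Fact tabloid_act_subproof (T : tabloid) (s : 'S_n) :
  [set tab_act t s | t in (T : {set tableau})] \in tabloids.
Proof.
have /imsetP[t _ ->] := tabloidP T.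
apply/imsetP; exists (tab_act t s) => //; apply/setP => u.
apply/imsetP/idP => [[v] | ].
  by rewrite !inE => tv ->; rewrite row_equiv_act.
rewrite !inE => tu; exists (tab_act u s^-1); last by rewrite -tab_actM mulVg tab_act1.
by rewrite !inE -(row_equiv_act s) -tab_actM mulVg tab_act1.
Qed.

Definition tabloid_act (T : tabloid) (s : 'S_n) : tabloid :=
  Tabloid (tabloid_act_subproof T s).

Lemma tabloid_act1 T : tabloid_act T 1 = T.
Proof.
apply/val_inj; rewrite /= -[RHS]imset_id.
by apply: eq_imset => t; rewrite tab_act1.
Qed.

Lemma tabloid_actM T : act_morph tabloid_act T.
Proof.
move=> s1 s2; apply/val_inj; rewrite /= -imset_comp.
by apply: eq_imset => t; rewrite /= tab_actM.
Qed.

Canonical tabloid_action := TotalAction tabloid_act1 tabloid_actM.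

(* Every polytabloid generates the same submodule; the Specht module is       *)
(* defined below from the tableau filled in the enumeration order of cells.   *)
Fact canonical_tableau_subproof :
  injectiveb [ffun c : cell => cast_ord card_cell (enum_rank c)].
Proof.
by apply/injectiveP => c d; rewrite !ffunE => /cast_ord_inj/enum_rank_inj.
Qed.

Definition canonical_tableau : tableau := Tableau canonical_tableau_subproof.

End Tableaux.

Section PermutationModule.

Variables (K : fieldType) (gT : finGroupType) (T : finType).
Variable to : {action gT &-> T}.

Definition perm_vec (x : T) : 'rV[K]_#|T| := delta_mx 0 (enum_rank x).

Definition perm_rep_mx (g : gT) : 'M[K]_#|T| :=
  \matrix_i perm_vec (to (enum_val i) g).

Lemma perm_vec_act x g : perm_vec x *m perm_rep_mx g = perm_vec (to x g).
Proof. by rewrite -rowE rowK enum_rankK. Qed.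

Fact perm_rep_subproof : mx_repr [set: gT] perm_rep_mx.
Proof.
split=> [|g h _ _]; apply/row_matrixP => i.
  by rewrite rowK row1 act1 /perm_vec enum_valK.
by rewrite row_mul !rowK perm_vec_act actM.
Qed.

Definition perm_rep : mx_representation K [set: gT]%G #|T| :=
  MxRepresentation perm_rep_subproof.

End PermutationModule.

Section Modules.

Variables (K : fieldType) (gT : finGroupType) (G : {group gT}).

Definition mx_indecomposable n (rG : mx_representation K G n) : Prop :=
  (0 < n)%N /\
  forall U V : 'M[K]_n, mxmodule rG U -> mxmodule rG V ->
    (U + V :=: 1%:M)%MS -> mxdirect (U + V) -> U = 0 \/ V = 0.

(* The Prop version of mxsplits rG 1%:M U.                                    *)
Definition mx_summand n (rG : mx_representation K G n) (U : 'M[K]_n) : Prop :=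
  exists W : 'M[K]_n,
    [/\ mxmodule rG W, (U + W :=: 1%:M)%MS & mxdirect (U + W)].

Definition is_decomposition n (rG : mx_representation K G n)
    (s : seq (representation K G)) : Prop :=
  (forall i : 'I_(size s), mx_indecomposable (nth grepr0 s i)) /\
  mx_rsim rG (\big[dadd_grepr/grepr0]_(r <- s) r).

(* [M : Y] = k: M decomposes into indecomposables, and each decomposition has *)
(* exactly k summands isomorphic to Y.                                        *)
Definition is_multiplicity n (rG : mx_representation K G n)
    m (rY : mx_representation K G m) (k : nat) : Prop :=
  (exists s, is_decomposition rG s) /\
  forall s, is_decomposition rG s ->
    count (fun r : representation K G => `[< mx_rsim r rY >]) s = k.

End Modules.

Section OuterTensor.

Variables (K : fieldType) (gT hT : finGroupType).
Variables (G : {group gT}) (H : {group hT}).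
Variables (m n : nat).
Variables (rG : mx_representation K G m) (rH : mx_representation K H n).

Fact outer_tensor_subproof :
  mx_repr (setX G H) (fun x : gT * hT => tprod (rG x.1) (rH x.2)).
Proof.
split=> [|[x1 x2] [y1 y2]] /=; first by rewrite !repr_mx1 tprod1.
rewrite !inE /= => /andP[Gx1 Hx2] /andP[Gy1 Hy2].
by rewrite !repr_mxM // tprodE.
Qed.

Definition outer_tensor : mx_representation K (setX_group G H) (m * n) :=
  MxRepresentation outer_tensor_subproof.

End OuterTensor.

Section YoungModules.

Variable K : fieldType.

Definition tabloid_module n (lam : intpart n) :
    mx_representation K [set: 'S_n]%G #|{: tabloid lam}| :=
  perm_rep K (tabloid_action lam).

Definition polytabloid n (lam : intpart n) (t : tableau lam) :
    'rV[K]_#|{: tabloid lam}| :=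
  perm_vec K (tabloid_of t) *m
    \sum_(s in col_stab t) (-1) ^+ s *: tabloid_module lam s.

Definition specht_mx n (lam : intpart n) : 'M[K]_#|{: tabloid lam}| :=
  cyclic_mx (tabloid_module lam) (polytabloid (canonical_tableau lam)).

Definition is_young_module n (lam : intpart n)
    (rY : representation K [set: 'S_n]%G) : Prop :=
  exists (U : 'M_#|{: tabloid lam}|) (modU : mxmodule (tabloid_module lam) U),
    [/\ mx_summand (tabloid_module lam) U,
        mx_indecomposable (submod_repr modU),
        (specht_mx lam <= U)%MS
      & mx_rsim rY (submod_repr modU)].

(* Existence follows from James's submodule theorem and uniqueness up to      *)
(* isomorphism from the Krull-Schmidt theorem; neither is used here, and the  *)
(* value grepr0 would only be returned if no Young module existed.            *)
Definition young_module n (lam : intpart n) : representation K [set: 'S_n]%G :=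
  if pselect (exists rY, is_young_module lam rY) is left ex
  then sval (cid ex) else grepr0.

Definition tabloid_module2 a b (l : intpart a * intpart b) :=
  outer_tensor (tabloid_module l.1) (tabloid_module l.2).

Definition young_module2 a b (l : intpart a * intpart b) :
    representation K (setX_group [set: 'S_a] [set: 'S_b]) :=
  Representation (outer_tensor (young_module l.1) (young_module l.2)).

End YoungModules.

Definition dominates2 a b (l m : intpart a * intpart b) : bool :=
  dominates l.1 m.1 && dominates l.2 m.2.

(* Main.v *)
(** Let e_k be the projector of the permutation module on words of length n
    over the alphabet 'I_n onto the words of content k, so that M^lambda is
    the image of e_lambda.  Every endomorphism of this image is a scalar plus
    a sum of maps that factor through images of e_k with k strictly dominating
    lambda, and such maps kill the polytabloid generating S^lambda.  Hence an
    endomorphism of M^lambda acts on this polytabloid by a scalar, and exactly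
    one indecomposable summand of M^lambda has a projection with a nonzero
    scalar: this summand is Y^lambda.  Any other indecomposable summand
    also occurs at a strictly larger content, so climbing the dominance order
    identifies it with a Young module.  The same eigenvector makes the residue
    field of End(Y^lambda) equal to K, which is what keeps outer tensor
    products of Young modules indecomposable over an arbitrary field; the
    theorem then follows from the Krull-Schmidt theorem. *)

Require Import Defs.
From HB Require Import structures.
From mathcomp Require Import all_boot all_order all_algebra all_fingroup.
From mathcomp Require Import all_solvable all_field all_character.

Set Implicit Arguments.
Unset Strict Implicit.
Unset Printing Implicit Defensive.

Import GRing.Theory.
Local Open Scope ring_scope.

(** * Intertwining matrices and Fitting's lemma *)

Section Intertwiners.

Variables (K : fieldType) (gT : finGroupType) (G : {group gT}).
Local Notation reprG := (mx_representation K G).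

(** Inside the single word module, maps between different permutation modules become square matrices
    of one algebra, spanned by orbit sums indexed by integer matrices whose row and column sums are
    the two contents. For equal contents, a non-diagonal index is pushed towards the diagonal: its
    orbit sum has coefficient exactly 1 in a product factoring through a larger content, so no
    coefficient has to be inverted. The contents met on the way are compositions, so the climb must
    also handle contents out of order. Maps through larger contents kill the polytabloid because the
    signed column sum lies in the group algebra, hence commutes with every endomorphism, and
    annihilates each word that repeats a letter within a column. The rest relies on one property of
    local endomorphism rings: an invertible sum has an invertible term. Summands are therefore pairs
    of maps with A B = 1 rather than subspaces, and cutting such an identity into a sum (along a
    direct sum, a tensor index or an ideal) produces a new summand. *)

Definition mxhom n1 (r1 : reprG n1) n2 (r2 : reprG n2) (A : 'M[K]_(n1, n2)) :=
  forall x, x \in G -> r1 x *m A = A *m r2 x.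

Definition is_summand n1 (r1 : reprG n1) n2 (r2 : reprG n2) :=
  exists A B, [/\ mxhom r1 r2 A, mxhom r2 r1 B & A *m B = 1%:M].

(** The endomorphism ring is local. Positive degree excludes the zero module, whose only
    endomorphism is invertible as an empty matrix. *)
Definition local_repr n (r : reprG n) :=
  (0 < n)%N /\
  forall A, mxhom r r A -> (A \in unitmx) || (1%:M - A \in unitmx).

Lemma mxhom1 n (r : reprG n) : mxhom r r 1%:M.
Proof. by move=> x _; rewrite mulmx1 mul1mx. Qed.

Lemma mxhom0 n1 (r1 : reprG n1) n2 (r2 : reprG n2) : mxhom r1 r2 0.
Proof. by move=> x _; rewrite mulmx0 mul0mx. Qed.

Lemma mxhomM n1 (r1 : reprG n1) n2 (r2 : reprG n2) n3 (r3 : reprG n3) A B :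
  mxhom r1 r2 A -> mxhom r2 r3 B -> mxhom r1 r3 (A *m B).
Proof. by move=> hA hB x Gx; rewrite mulmxA hA // -!mulmxA hB. Qed.

Lemma mxhomD n1 (r1 : reprG n1) n2 (r2 : reprG n2) A B :
  mxhom r1 r2 A -> mxhom r1 r2 B -> mxhom r1 r2 (A + B).
Proof. by move=> hA hB x Gx; rewrite mulmxDr mulmxDl hA ?hB. Qed.

Lemma mxhomZ n1 (r1 : reprG n1) n2 (r2 : reprG n2) c A :
  mxhom r1 r2 A -> mxhom r1 r2 (c *: A).
Proof. by move=> hA x Gx; rewrite -scalemxAr -scalemxAl hA. Qed.

Lemma mxhomB n1 (r1 : reprG n1) n2 (r2 : reprG n2) A B :
  mxhom r1 r2 A -> mxhom r1 r2 B -> mxhom r1 r2 (A - B).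
Proof. by move=> hA hB; rewrite -scaleN1r; apply/mxhomD/mxhomZ. Qed.

Lemma mxhom_sum n1 (r1 : reprG n1) n2 (r2 : reprG n2) I (s : seq I) (P : pred I) F :
  (forall i, P i -> mxhom r1 r2 (F i)) -> mxhom r1 r2 (\sum_(i <- s | P i) F i).
Proof.
by move=> hF; elim/big_rec: _ => [|i A Pi]; [apply: mxhom0 | apply/mxhomD/hF].
Qed.

Lemma mxhomV n (r1 r2 : reprG n) A :
  mxhom r1 r2 A -> A \in unitmx -> mxhom r2 r1 (invmx A).
Proof.
move=> hA uA x Gx.
by rewrite -[LHS](mulKmx uA) (mulmxA A) -hA // -!mulmxA mulmxV // mulmx1.
Qed.

(** A two-sided inverse replaces the equality of degrees in [mx_rsim], which would force casts. *)
Lemma rsimP n1 (r1 : reprG n1) n2 (r2 : reprG n2) :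
  mx_rsim r1 r2 <->
  exists A B, [/\ mxhom r1 r2 A, mxhom r2 r1 B, A *m B = 1%:M & B *m A = 1%:M].
Proof.
split=> [[A e fA hA] | [A [B [hA hB AB BA]]]].
  case: _ / e A r2 fA hA => A r2; rewrite row_free_unit => uA hA.
  exists A, (invmx A); rewrite mulmxV ?mulVmx //; split=> //.
  exact: mxhomV.
exists A => //; last by apply/row_freeP; exists B.
apply/eqP; rewrite eqn_leq; apply/andP; split.
  by rewrite -(mxrank1 K n1) -AB mulmx_max_rank.
by rewrite -(mxrank1 K n2) -BA mulmx_max_rank.
Qed.

Lemma rsim_summand n1 (r1 : reprG n1) n2 (r2 : reprG n2) :
  mx_rsim r1 r2 -> is_summand r1 r2.
Proof. by case/rsimP=> A [B [hA hB AB _]]; exists A, B. Qed.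

Lemma summand_trans n1 (r1 : reprG n1) n2 (r2 : reprG n2) n3 (r3 : reprG n3) :
  is_summand r1 r2 -> is_summand r2 r3 -> is_summand r1 r3.
Proof.
move=> [A [B [hA hB AB]]] [C [D [hC hD CD]]]; exists (A *m C), (D *m B).
split; [exact: mxhomM hA hC | exact: mxhomM hD hB |].
by rewrite mulmxA -(mulmxA A) CD mulmx1.
Qed.

Lemma summand_unit n1 (r1 : reprG n1) n2 (r2 : reprG n2) A B :
  mxhom r1 r2 A -> mxhom r2 r1 B -> A *m B \in unitmx -> is_summand r1 r2.
Proof.
move=> hA hB u; exists A, (B *m invmx (A *m B)).
split=> //; last by rewrite mulmxA mulmxV.
exact: mxhomM hB (mxhomV (mxhomM hA hB) u).
Qed.

Lemma mxhom_module n (r : reprG n) E : mxhom r r E -> mxmodule r E.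
Proof. by move=> hE; apply/mxmoduleP=> x Gx; rewrite -hE ?submxMl. Qed.

Lemma idem_summand n (r : reprG n) E : mxhom r r E -> E *m E = E ->
  [/\ mxmodule r (1%:M - E), (E + (1%:M - E) :=: 1%:M)%MS
    & mxdirect (E + (1%:M - E))].
Proof.
move=> hE EE; split; first exact/mxhom_module/(mxhomB (@mxhom1 _ r)).
  apply/eqmxP; rewrite submx1 /= -{1}[1%:M](subrK E) addrC.
  by rewrite addmx_sub_adds.
apply/mxdirect_addsP/eqP/rowV0P=> x; rewrite sub_capmx => /andP[/submxP[u ->]].
case/submxP=> w e; rewrite -{1}EE mulmxA e -mulmxA mulmxBl mul1mx EE subrr.
exact: mulmx0.
Qed.

Lemma mxhom_proj n (r : reprG n) U V : mxmodule r U -> mxmodule r V ->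
  (U + V :=: 1%:M)%MS -> mxdirect (U + V) -> mxhom r r (proj_mx U V).
Proof.
move=> modU modV UV1 /mxdirect_addsP tiUV x Gx.
have le : (1%:M <= U + V)%MS by rewrite UV1.
have /hom_mxP/(_ x Gx) := submx_trans le (proj_mx_hom tiUV modU modV).
by rewrite !mul1mx.
Qed.

Lemma indecomposable_idem n (r : reprG n) E : mx_indecomposable r ->
  mxhom r r E -> E *m E = E -> E = 0 \/ E = 1%:M.
Proof.
move=> [_ dec_r] hE EE; have [mod1E adds1 dx1] := idem_summand hE EE.
have [-> | /eqP] := dec_r _ _ (mxhom_module hE) mod1E adds1 dx1; first by left.
by rewrite subr_eq0 => /eqP <-; right.
Qed.

Lemma idem_indecomposable n (r : reprG n) : (0 < n)%N ->
    (forall E, mxhom r r E -> E *m E = E -> E = 0 \/ E = 1%:M) ->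
  mx_indecomposable r.
Proof.
move=> n_gt0 idem_r; split=> // U V modU modV UV1 dxUV.
have tiUV := mxdirect_addsP dxUV.
have hE := mxhom_proj modU modV UV1 dxUV.
have PU : (proj_mx U V <= U)%MS by rewrite -[proj_mx U V]mul1mx proj_mx_sub.
have EE : proj_mx U V *m proj_mx U V = proj_mx U V by rewrite proj_mx_id.
have [P0 | P1] := idem_r _ hE EE; [left | right].
  by rewrite -[U](proj_mx_id tiUV) // P0 mulmx0.
by rewrite -[V]mulmx1 -P1 proj_mx_0.
Qed.

Lemma rsim_indecomposable n1 (r1 : reprG n1) n2 (r2 : reprG n2) :
  mx_rsim r1 r2 -> mx_indecomposable r1 -> mx_indecomposable r2.
Proof.
move=> sim12 ind1; have n1n2 := mxrank_rsim sim12.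
have [n_gt0 _] := ind1; case/rsimP: sim12 => A [B [hA hB AB BA]].
apply: idem_indecomposable => [|E hE EE]; first by rewrite -n1n2.
have EK : E = B *m (A *m E *m B) *m A.
  by rewrite !mulmxA BA mul1mx -mulmxA BA mulmx1.
have [||e|e] := indecomposable_idem ind1 (E := A *m E *m B).
- exact: mxhomM (mxhomM hA hE) hB.
- by rewrite !mulmxA -(mulmxA _ B) BA mulmx1 -(mulmxA A) EE.
- by left; rewrite EK e mulmx0 mul0mx.
by right; rewrite EK e mulmx1 BA.
Qed.

(** [A] is the inclusion of [U] and [B] the projection along a complement; the last clause will say
    that this projection fixes the polytabloid. *)
Lemma submod_split n (r : reprG n) U (modU : mxmodule r U) : mx_summand r U ->
  exists A B, [/\ mxhom (submod_repr modU) r A, mxhom r (submod_repr modU) B,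
    A *m B = 1%:M & forall v : 'rV_n, (v <= U)%MS -> v *m B *m A = v].
Proof.
move=> [W [modW UW1 dxUW]]; have tiUW := mxdirect_addsP dxUW.
have hP := mxhom_proj modU modW UW1 dxUW.
have PU : (proj_mx U W <= U)%MS by rewrite -[proj_mx U W]mul1mx proj_mx_sub.
have inE k (X : 'M_(k, n)) :
    X *m in_submod U (proj_mx U W) = in_submod U (X *m proj_mx U W).
  by rewrite [RHS]in_submodE -mulmxA -in_submodE.
exists (val_submod 1%:M), (in_submod U (proj_mx U W)); split.
- by move=> x Gx; rewrite /= -val_submodE -[submod_mx _ x]mul1mx val_submodJ.
- by move=> x Gx; rewrite /= -in_submodJ // -hP // inE.
- by rewrite inE proj_mx_id ?val_submodP // val_submodK.
by move=> v vU; rewrite inE proj_mx_id // -val_submodE in_submodK.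
Qed.

(** Fitting's lemma: the generalised kernel of [A] and the kernel of the part of its characteristic
    polynomial prime to X split the module, so [A] is injective or nilpotent, and in the nilpotent
    case a geometric series inverts 1 - A. *)
Lemma indecomposable_local n (r : reprG n) :
  mx_indecomposable r -> local_repr r.
Proof.
move=> [n_gt0 dec_r]; split=> // A hA.
have [//|nuA /=] := boolP (A \in unitmx).
case: n => [//|n] in r n_gt0 dec_r A hA nuA *.
have cp0 : char_poly A != 0 by apply: monic_neq0; apply: char_poly_monic.
have [k [q rq def_p]] := multiplicity_XsubC (char_poly A) 0.
rewrite cp0 /= subr0 in rq def_p.
(* The exponent [k.+1] instead of [k] keeps a factor X even if 0 is not an eigenvalue, so that the
   first kernel always contains the kernel of [A]. *)
have cop : coprimep ('X ^+ k.+1) q.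
  by rewrite coprimep_expl // coprimep_sym -['X]subr0 coprimep_XsubC.
have modk p : mxmodule r (kermxpoly A p).
  by apply/mxmoduleP=> x Gx; apply: comm_mx_stable_kermxpoly; rewrite /comm_mx hA.
have UV1 : (kermxpoly A ('X ^+ k.+1) + kermxpoly A q :=: 1%:M)%MS.
  apply: eqmx_trans (eqmx_sym (kermxpolyM A cop)) _; apply: kermxpoly_min.
  apply: dvdp_trans (mxminpoly_dvd_char A) _; rewrite def_p mulrC.
  by rewrite exprS -mulrA dvdp_mulIr.
have [||U0 | V0] := dec_r _ _ (modk ('X ^+ k.+1)) (modk q).
- exact: UV1.
- by apply/mxdirect_addsP; apply: mxdirect_kermxpoly.
- case/negP: nuA; rewrite -row_free_unit -kermx_eq0 -submx0 -U0.
  apply/sub_kermxP; rewrite exprS rmorphM /= horner_mx_X mulmxA mulmx_ker.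
  by rewrite mul0mx.
have A0 : A ^+ k.+1 = 0.
  move: UV1; rewrite V0 /kermxpoly rmorphXn /= horner_mx_X => e.
  have: (1%:M <= kermx (A ^+ k.+1))%MS by rewrite -e addsmx0.
  by move/sub_kermxP; rewrite mul1mx.
have: 1 - A ^+ k.+1 = 1 by rewrite A0 subr0.
by rewrite -opprB subrX1 -mulNr opprB => /mulmx1_unit[].
Qed.

Section Local.

Variables (n : nat) (r : reprG n).
Hypothesis loc_r : local_repr r.

Lemma local_unitD A B : mxhom r r A -> mxhom r r B -> A + B \in unitmx ->
  (A \in unitmx) || (B \in unitmx).
Proof.
move=> hA hB uAB; have hI := mxhomV (mxhomD hA hB) uAB.
have [_ /(_ (A *m invmx (A + B)))] := loc_r.
have -> : 1%:M - A *m invmx (A + B) = B *m invmx (A + B).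
  by rewrite -(mulmxV uAB) mulmxDl addrC addKr.
by rewrite !unitmx_mul unitmx_inv uAB !andbT; apply; apply: mxhomM hI.
Qed.

Lemma local_unit0 : (0 : 'M[K]_n) \in unitmx -> False.
Proof.
have [n_gt0 _] := loc_r; rewrite -row_free_unit /row_free mxrank0 => /eqP e.
by rewrite -e in n_gt0.
Qed.

Lemma local_unit_sum (I : eqType) (s : seq I) (P : pred I) F :
    (forall i, P i -> mxhom r r (F i)) ->
    \sum_(i <- s | P i) F i \in unitmx ->
  exists i, [/\ i \in s, P i & F i \in unitmx].
Proof.
move=> hF; elim: s => [|i s IHs]; first by rewrite big_nil => /local_unit0.
rewrite big_cons; case: ifP => Pi; last first.
  by case/IHs=> j [sj Pj uj]; exists j; rewrite inE sj orbT.
case/local_unitD/orP; [exact: hF|exact: mxhom_sum| |].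
  by move=> uFi; exists i; rewrite mem_head.
by case/IHs=> j [sj Pj uj]; exists j; rewrite inE sj orbT.
Qed.

(** [B *m A] is an idempotent endomorphism of the indecomposable [r'], hence 0 or 1, and 0 would
    force [r] to be zero. *)
Lemma summand_local_rsim m (r' : reprG m) :
  mx_indecomposable r' -> is_summand r r' -> mx_rsim r r'.
Proof.
move=> ind_r' [A [B [hA hB AB]]].
have BABA : B *m A *m (B *m A) = B *m A by rewrite mulmxA -(mulmxA B) AB mulmx1.
have [BA0 | BA1] := indecomposable_idem ind_r' (mxhomM hB hA) BABA.
- case: local_unit0; rewrite -[0](mulmx0 _ A) -[in A *m 0](mul0mx _ B) -BA0.
  by rewrite -mulmxA AB mulmx1 AB unitmx1.
by apply/rsimP; exists A, B.
Qed.

End Local.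

End Intertwiners.

(** * Direct sums and the Krull-Schmidt theorem *)

Section DirectSums.

Variables (K : fieldType) (gT : finGroupType) (G : {group gT}).
Local Notation reprG := (mx_representation K G).
Local Notation repG := (representation K G).
Local Notation dsum s := (\big[dadd_grepr/grepr0]_(r <- s) r).

Lemma mxhom_row n (r : reprG n) (r1 r2 : repG) A B :
  mxhom r (dadd_grepr r1 r2) (row_mx A B) <-> mxhom r r1 A /\ mxhom r r2 B.
Proof.
split=> [h | [hA hB] x Gx].
  split=> x Gx; have := h x Gx; rewrite mul_mx_row mul_row_block !mulmx0 addr0;
    by rewrite add0r => /eq_row_mx[].
by rewrite mul_mx_row mul_row_block !mulmx0 addr0 add0r hA ?hB.
Qed.

Lemma mxhom_col n (r : reprG n) (r1 r2 : repG) A B :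
  mxhom (dadd_grepr r1 r2) r (col_mx A B) <-> mxhom r1 r A /\ mxhom r2 r B.
Proof.
split=> [h | [hA hB] x Gx].
  split=> x Gx; have := h x Gx; rewrite mul_block_col mul_col_mx !mul0mx addr0;
    by rewrite add0r => /eq_col_mx[].
by rewrite mul_block_col mul_col_mx !mul0mx addr0 add0r hA ?hB.
Qed.

Lemma mxhom_lr n (r : reprG n) (r1 r2 : repG) A :
  mxhom r (dadd_grepr r1 r2) A -> mxhom r r1 (lsubmx A) /\ mxhom r r2 (rsubmx A).
Proof. by rewrite -{1}[A]hsubmxK => /mxhom_row. Qed.

Lemma mxhom_ud n (r : reprG n) (r1 r2 : repG) A :
  mxhom (dadd_grepr r1 r2) r A -> mxhom r1 r (usubmx A) /\ mxhom r2 r (dsubmx A).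
Proof. by rewrite -{1}[A]vsubmxK => /mxhom_col. Qed.

Lemma rsim_dadd (r1 r2 s1 s2 : repG) : mx_rsim r1 s1 -> mx_rsim r2 s2 ->
  mx_rsim (dadd_grepr r1 r2) (dadd_grepr s1 s2).
Proof.
move=> /rsimP[A [B [hA hB AB BA]]] /rsimP[C [D [hC hD CD DC]]].
apply/rsimP; exists (block_mx A 0 0 C), (block_mx B 0 0 D).
split.
- apply/mxhom_col; split; apply/mxhom_row; split=> //; exact: mxhom0.
- apply/mxhom_col; split; apply/mxhom_row; split=> //; exact: mxhom0.
- by rewrite mulmx_block !mulmx0 !mul0mx !addr0 add0r AB CD -scalar_mx_block.
- by rewrite mulmx_block !mulmx0 !mul0mx !addr0 add0r BA DC -scalar_mx_block.
Qed.

Lemma rsim_daddC (r1 r2 : repG) :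
  mx_rsim (dadd_grepr r1 r2) (dadd_grepr r2 r1).
Proof.
apply/rsimP; exists (block_mx 0 1%:M 1%:M 0), (block_mx 0 1%:M 1%:M 0).
split.
- apply/mxhom_col; split; apply/mxhom_row; split; try exact: mxhom0; exact: mxhom1.
- apply/mxhom_col; split; apply/mxhom_row; split; try exact: mxhom0; exact: mxhom1.
- by rewrite mulmx_block !mulmx0 !mul0mx !addr0 !add0r !mulmx1 -scalar_mx_block.
- by rewrite mulmx_block !mulmx0 !mul0mx !addr0 !add0r !mulmx1 -scalar_mx_block.
Qed.

Lemma rsim_daddA (r1 r2 r3 : repG) :
  mx_rsim (dadd_grepr r1 (dadd_grepr r2 r3)) (dadd_grepr (dadd_grepr r1 r2) r3).
Proof.
apply/rsimP.
exists (block_mx (row_mx 1%:M 0) 0 (block_mx 0 1%:M 0 0) (col_mx 0 1%:M)).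
exists (block_mx (col_mx 1%:M 0) (block_mx 0 0 1%:M 0) 0 (row_mx 0 1%:M)).
split.
- apply/mxhom_col; split; apply/mxhom_row; split; try exact: mxhom0;
    try (apply/mxhom_col; split); try (apply/mxhom_row; split); try exact: mxhom0;
    exact: mxhom1.
- apply/mxhom_col; split; apply/mxhom_row; split; try exact: mxhom0;
    try (apply/mxhom_col; split); try (apply/mxhom_row; split); try exact: mxhom0;
    exact: mxhom1.
- rewrite mulmx_block !mulmx0 !mul0mx !addr0 mul_row_col mul_row_block.
  rewrite mul_block_col mulmx_block mul_col_row.
  rewrite !(mulmx1, mulmx0, mul0mx, mul1mx) add_block_mx ?addr0 !add0r.
  by rewrite row_mx0 col_mx0 -!scalar_mx_block.
- rewrite mulmx_block !mulmx0 !mul0mx !add0r mul_row_block.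
  rewrite mulmx_block mul_col_row mul_block_col mul_row_col.
  rewrite !(mulmx1, mulmx0, mul0mx, mul1mx) add_block_mx ?addr0 !add0r.
  by rewrite row_mx0 col_mx0 -!scalar_mx_block.
Qed.

Lemma rsim_dadd0 (r : repG) : mx_rsim (dadd_grepr grepr0 r) r.
Proof.
apply/rsimP; exists (col_mx 0 1%:M), (row_mx 0 1%:M); split.
- by apply/mxhom_col; split; [apply: mxhom0 | apply: mxhom1].
- by apply/mxhom_row; split; [apply: mxhom0 | apply: mxhom1].
- rewrite mul_col_row !mulmx0 mul0mx mulmx1 [RHS]scalar_mx_block.
  by congr block_mx; apply/matrixP=> [[]].
- by rewrite mul_row_col mulmx0 add0r mulmx1.
Qed.

(** When the corner u of F is invertible, its Schur complement d - c u^-1 b is an isomorphism, with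
    inverse the lower right corner d' of H. *)
Lemma dadd_unit_cancel (X A B : repG) F H :
    mxhom (dadd_grepr X A) (dadd_grepr X B) F ->
    mxhom (dadd_grepr X B) (dadd_grepr X A) H ->
    F *m H = 1%:M -> H *m F = 1%:M -> ulsubmx F \in unitmx ->
  mx_rsim A B.
Proof.
rewrite -{1 2 3}[F]submxK -{1 2 3}[H]submxK.
move: (ulsubmx F) (ursubmx F) (dlsubmx F) (drsubmx F) => u b c d.
move: (ulsubmx H) (ursubmx H) (dlsubmx H) (drsubmx H) => u' b' c' d'.
move=> /mxhom_col[/mxhom_row[hu hb] /mxhom_row[hc hd]].
move=> /mxhom_col[_ /mxhom_row[_ hd']].
rewrite !mulmx_block !scalar_mx_block.
move=> /eq_block_mx[_ e1 _ e2] /eq_block_mx[_ _ e3 e4] uu.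
have hui := mxhomV hu uu.
apply/rsimP; exists (d - c *m invmx u *m b), d'; split=> //.
- exact: mxhomB hd (mxhomM (mxhomM hc hui) hb).
- rewrite mulmxBl -(mulmxA _ b) -[b *m d'](addKr (u *m b')) e1 addr0 mulmxN opprK.
  by rewrite -(mulmxA c) mulKmx // addrC.
- rewrite mulmxBr !mulmxA -[d' *m c](addKr (c' *m u)) e3 addr0 !mulNmx opprK.
  by rewrite mulmxK // addrC.
Qed.

Lemma dadd_cancel (X A B : repG) : local_repr X ->
  mx_rsim (dadd_grepr X A) (dadd_grepr X B) -> mx_rsim A B.
Proof.
move=> locX /rsimP[F [H [hF hH FH HF]]].
have [uF | nuF] := boolP (ulsubmx F \in unitmx); first
  exact: dadd_unit_cancel hF hH FH HF uF.
(* If the corner u of F is not invertible, the corner of F H = 1 reads u u' + b c = 1, so locality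
   makes b c invertible, and then also u + b c. The transvection [T c] replaces the corner u by u +
   b c, which reduces to the case of an invertible corner. *)
pose T (c : 'M[K]_(rdegree B, rdegree X)) : 'M_(rdegree X + rdegree B) :=
  block_mx 1%:M 0 c 1%:M.
pose c := dlsubmx H.
have TK a1 a2 : a1 + a2 = 0 -> T a1 *m T a2 = 1%:M.
  move=> a12; rewrite /T mulmx_block !(mulmx1, mulmx0, mul1mx, mul0mx, addr0, add0r).
  by rewrite a12 -scalar_mx_block.
have [/mxhom_lr[hu hb] _] := mxhom_ud hF.
have [/mxhom_lr[hu' _] /mxhom_lr[hc _]] := mxhom_ud hH.
have hT a : mxhom B X a -> mxhom (dadd_grepr X B) (dadd_grepr X B) (T a).
  move=> ha; apply/mxhom_col; split; apply/mxhom_row; split=> //; 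
    try exact: mxhom1; exact: mxhom0.
have hcN : mxhom B X (- c) by rewrite -scaleN1r; apply: mxhomZ.
apply: (@dadd_unit_cancel X A B (F *m T c) (T (- c) *m H)).
- exact: mxhomM hF (hT _ hc).
- exact: mxhomM (hT _ hcN) hH.
- by rewrite mulmxA -(mulmxA F) TK ?mulmx1 // subrr.
- by rewrite mulmxA -(mulmxA _ H) HF mulmx1 TK // addNr.
have -> : ulsubmx (F *m T c) = ulsubmx F + ursubmx F *m c.
  by rewrite -[F in F *m _]submxK mulmx_block block_mxKul mulmx1.
have e : ulsubmx F *m ulsubmx H + ursubmx F *m c = 1%:M.
  move: FH; rewrite -[F]submxK -[H]submxK mulmx_block scalar_mx_block.
  by case/eq_block_mx; rewrite !submxK.
have hbc := mxhomM hb hc.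
have /(local_unitD locX (mxhomM hu hu') hbc)/orP[] :
    ulsubmx F *m ulsubmx H + ursubmx F *m c \in unitmx by rewrite e unitmx1.
  by rewrite unitmx_mul (negPf nuF).
rewrite -{1}[ursubmx F *m c](addKr (ulsubmx F)) addrC.
have hNu : mxhom X X (- ulsubmx F) by rewrite -scaleN1r; apply: mxhomZ.
case/(local_unitD locX (mxhomD hu hbc) hNu)/orP=> //.
by rewrite -scaleN1r unitmxZ ?unitrN1 // (negPf nuF).
Qed.

Lemma summand_dadd n (r : reprG n) (r1 r2 : repG) : local_repr r ->
  is_summand r (dadd_grepr r1 r2) -> is_summand r r1 \/ is_summand r r2.
Proof.
move=> loc_r [A [B [/mxhom_lr[hA1 hA2] /mxhom_ud[hB1 hB2]]]].
rewrite -{1}[A]hsubmxK -{1}[B]vsubmxK mul_row_col => e.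
have := unitmx1 K n; rewrite -e.
case/(local_unitD loc_r (mxhomM hA1 hB1) (mxhomM hA2 hB2))/orP => u; [left|right].
  exact: summand_unit _ _ u.
exact: summand_unit _ _ u.
Qed.

Lemma rsim_dsum_cat (s1 s2 : seq repG) :
  mx_rsim (dsum (s1 ++ s2)) (dadd_grepr (dsum s1) (dsum s2)).
Proof.
elim: s1 => [|r s1 IHs]; first by rewrite big_nil; apply/mx_rsim_sym/rsim_dadd0.
rewrite cat_cons !big_cons; apply: mx_rsim_trans (rsim_daddA _ _ _).
exact: rsim_dadd (mx_rsim_refl _) IHs.
Qed.

Lemma rsim_dsum_mid (s1 s2 : seq repG) r :
  mx_rsim (dsum (s1 ++ r :: s2)) (dadd_grepr r (dsum (s1 ++ s2))).
Proof.
elim: s1 => [|r1 s1 IHs]; first by rewrite big_cons; apply: mx_rsim_refl.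
rewrite !cat_cons !big_cons; apply: mx_rsim_trans (rsim_dadd (mx_rsim_refl _) IHs) _.
apply: mx_rsim_trans (rsim_daddA _ _ _) _.
apply: mx_rsim_trans (mx_rsim_sym (rsim_daddA _ _ _)).
exact: rsim_dadd (rsim_daddC _ _) (mx_rsim_refl _).
Qed.

Lemma rsim_big_dadd (I : eqType) (s : seq I) (f g : I -> repG) :
    {in s, forall i, mx_rsim (f i) (g i)} ->
  mx_rsim (\big[dadd_grepr/grepr0]_(i <- s) f i)
          (\big[dadd_grepr/grepr0]_(i <- s) g i).
Proof.
elim: s => [|i s IHs] fg; first by rewrite !big_nil; apply: mx_rsim_refl.
rewrite !big_cons; apply: rsim_dadd; first by apply: fg; rewrite mem_head.
by apply: IHs => j sj; apply: fg; rewrite inE sj orbT.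
Qed.

Lemma dadd_summandl (r1 r2 : repG) : is_summand r1 (dadd_grepr r1 r2).
Proof.
exists (row_mx 1%:M 0), (col_mx 1%:M 0); split.
- by apply/mxhom_row; split; [apply: mxhom1 | apply: mxhom0].
- by apply/mxhom_col; split; [apply: mxhom1 | apply: mxhom0].
- by rewrite mul_row_col mulmx0 addr0 mulmx1.
Qed.

Lemma nth_summand_dsum (s : seq repG) i : (i < size s)%N ->
  is_summand (nth grepr0 s i) (dsum s).
Proof.
elim: s i => [|r s IHs] [|i] //=; rewrite ?ltnS big_cons => lti.
  exact: dadd_summandl.
apply: summand_trans (IHs _ lti) _; apply: summand_trans (dadd_summandl _ r) _.
exact/rsim_summand/rsim_daddC.
Qed.

Lemma summand_dsum n (r : reprG n) (s : seq repG) : local_repr r ->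
  is_summand r (dsum s) ->
  exists2 i, (i < size s)%N & is_summand r (nth grepr0 s i).
Proof.
move=> loc_r; elim: s => [|r1 s IHs].
  rewrite big_nil => [[A [B [_ _]]]]; rewrite [A]thinmx0 mul0mx => e.
  by case: (local_unit0 loc_r); rewrite e unitmx1.
rewrite big_cons => /(summand_dadd loc_r)[sum_r1 | /IHs[i lti sum_i]].
  by exists 0%N.
by exists i.+1.
Qed.

Definition all_rep (Q : repG -> Prop) (s : seq repG) :=
  forall i, (i < size s)%N -> Q (nth grepr0 s i).

Lemma all_rep_cons Q r s : all_rep Q (r :: s) <-> Q r /\ all_rep Q s.
Proof.
split=> [h | [hr hs] [|i] lti //]; last exact: hs.
by split=> [|i lti]; [apply: (h 0%N) | apply: (h i.+1)].
Qed.

Lemma all_rep_cat Q s1 s2 : all_rep Q (s1 ++ s2) <-> all_rep Q s1 /\ all_rep Q s2.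
Proof.
elim: s1 => [|r1 s1 IHs]; first by split=> [? | []].
split=> /= [/all_rep_cons[h1 /IHs[h hs]] | [/all_rep_cons[h1 h] hs]].
  by split=> //; apply/all_rep_cons.
by apply/all_rep_cons; split=> //; apply/IHs.
Qed.

Lemma all_rep_mid Q s1 r s2 :
  all_rep Q (s1 ++ r :: s2) <-> Q r /\ all_rep Q (s1 ++ s2).
Proof.
split=> [/all_rep_cat[h1 /all_rep_cons[hr h2]] | [hr /all_rep_cat[h1 h2]]].
  by split=> //; apply/all_rep_cat.
by apply/all_rep_cat; split=> //; apply/all_rep_cons.
Qed.

Local Notation indec_seq := (all_rep (fun r => mx_indecomposable r)).

Lemma split_nth (T : Type) (x0 : T) s i : (i < size s)%N ->
  exists s1 s2, s = s1 ++ nth x0 s i :: s2.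
Proof.
move=> lti; exists (take i s), (drop i.+1 s).
by rewrite -drop_nth // cat_take_drop.
Qed.

(** Counting by an isomorphism-invariant predicate states uniqueness without a permutation matching
    the two sequences. The head of [s] is local, hence isomorphic to some entry of [t], and both
    copies can be cancelled. *)
Lemma Krull_Schmidt_count (s t : seq repG) (P : repG -> bool) :
    (forall r r' : repG, mx_rsim r r' -> P r = P r') ->
    indec_seq s -> indec_seq t -> mx_rsim (dsum s) (dsum t) ->
  count P s = count P t.
Proof.
move=> simP; elim: s t => [|r s IHs] t ind_s ind_t sim_st.
  case: t ind_t sim_st => // r t /all_rep_cons[[r_gt0 _] _] /mxrank_rsim.
  by rewrite big_nil big_cons /= => e; rewrite -(ltn_add2r (rdegree (dsum t))) -e in r_gt0.
have /all_rep_cons[ind_r ind_s'] := ind_s.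
have loc_r := indecomposable_local ind_r.
have sum_r : is_summand r (dsum t).
  apply: summand_trans (rsim_summand sim_st).
  exact: (@nth_summand_dsum (r :: s) 0).
have [i lti sum_ri] := summand_dsum loc_r sum_r.
have := summand_local_rsim loc_r (ind_t i lti) sum_ri.
have [t1 [t2 def_t]] := split_nth grepr0 lti; move: (nth _ _ _) def_t => y def_t.
rewrite def_t in ind_t sim_st * => {sum_ri} sim_ry.
have /all_rep_mid[ind_y ind_t12] := ind_t.
rewrite count_cat /= (simP _ _ sim_ry) addnCA -count_cat; congr (_ + _)%N.
apply: IHs => //; apply: dadd_cancel loc_r _.
move: sim_st; rewrite big_cons => sim_st; apply: mx_rsim_trans sim_st _.
apply: mx_rsim_trans (rsim_dsum_mid _ _ _) _.
exact: rsim_dadd (mx_rsim_sym sim_ry) (mx_rsim_refl _).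
Qed.

Lemma is_decompositionP n (r : reprG n) s :
  is_decomposition r s <-> indec_seq s /\ mx_rsim r (dsum s).
Proof.
split=> [] [ind_s sim_s]; split=> // i; last exact: ind_s.
by move=> lti; apply: (ind_s (Ordinal lti)).
Qed.

Lemma decomposition_exists n (r : reprG n) : exists s, is_decomposition r s.
Proof.
suff [s [ind_s sim_s]] : exists s, indec_seq s /\ mx_rsim r (dsum s).
  by exists s; apply/is_decompositionP.
have [m] := ubnP n; elim: m => // m IHm in n r *; rewrite ltnS => le_nm.
case: (posnP n) => [n0 | n_gt0].
  exists [::]; split=> //; rewrite big_nil; case: _ / (esym n0) r => r.
  by exists 0 => // [|x _]; rewrite ?mulmx0 ?mul0mx // /row_free mxrank0.
case: (boolp.pselect (mx_indecomposable r)) => [ind_r | nind_r].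
  exists [:: Representation r]; split; first by case.
  rewrite big_cons big_nil; apply: mx_rsim_trans (rsim_daddC _ _).
  exact/mx_rsim_sym/rsim_dadd0.
have [U [V [modU modV UV1 [dxUV U0 V0]]]] : exists U V : 'M_n,
    [/\ mxmodule r U, mxmodule r V, (U + V :=: 1%:M)%MS
      & [/\ mxdirect (U + V), U != 0 & V != 0]].
  apply: boolp.contrapT => nex; case: nind_r; split=> // U V mU mV e dx.
  have [-> | U0] := eqVneq U 0; [by left | right].
  by apply/eqP; apply: boolp.contrapT => /negP V0; case: nex; exists U, V.
have rUV : (\rank U + \rank V = n)%N by rewrite -(mxdirectP dxUV) /= UV1 mxrank1.
have rU : (0 < \rank U)%N by rewrite lt0n mxrank_eq0.
have rV : (0 < \rank V)%N by rewrite lt0n mxrank_eq0.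
have [|sU [indU simU]] := IHm _ (submod_repr modU).
  by apply: leq_trans le_nm; rewrite -[X in (_ < X)%N]rUV -[X in (X < _)%N]addn0 ltn_add2l.
have [|sV [indV simV]] := IHm _ (submod_repr modV).
  by apply: leq_trans le_nm; rewrite -[X in (_ < X)%N]rUV -[X in (X < _)%N]add0n ltn_add2r.
exists (sU ++ sV); split; first by apply/all_rep_cat.
apply: mx_rsim_trans (mx_rsim_sym (rsim_dsum_cat _ _)).
apply: mx_rsim_trans (mx_rsim_dadd (mxmodule1 r) UV1 dxUV simU simV).
exact/mx_rsim_sym/rsim_submod1.
Qed.

End DirectSums.

(** * Outer tensor products *)

Section TensorIndex.

Variables (K : fieldType) (m n : nat).

Lemma tix_subproof (i : 'I_m) (j : 'I_n) : (i * n + j < m * n)%N.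
Proof.
case: i => i /= lti; apply: (@leq_trans (i.+1 * n)).
  by rewrite mulSn addnC ltn_add2r.
by rewrite leq_mul2r lti orbT.
Qed.

Definition tix i j : 'I_(m * n) := Ordinal (tix_subproof i j).

Lemma tix_inj i j k l : tix i j = tix k l -> i = k /\ j = l.
Proof.
move=> /(congr1 val) /= e.
have n_gt0 : (0 < n)%N by exact: leq_ltn_trans (leq0n _) (ltn_ord j).
have ei : i = k :> nat.
  by rewrite -[i : nat](addn0 i) -(divn_small (ltn_ord j)) -divnMDl // e divnMDl //
    divn_small ?addn0.
by split; apply: val_inj => //=; apply/eqP; rewrite -(eqn_add2l (i * n)) e ei.
Qed.

Lemma tix_surj (k : 'I_(m * n)) : exists i j, k = tix i j.
Proof.
have n_gt0 : (0 < n)%N.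
  by case: (posnP n) k => // -> [k]; rewrite muln0.
have lt1 : (k %/ n < m)%N by rewrite ltn_divLR.
have lt2 : (k %% n < n)%N by rewrite ltn_pmod.
exists (Ordinal lt1), (Ordinal lt2); apply: val_inj => /=; exact: divn_eq.
Qed.

Lemma sum_tix (V : nmodType) (F : 'I_(m * n) -> V) :
  \sum_k F k = \sum_i \sum_j F (tix i j).
Proof.
rewrite pair_big /= (reindex (fun p : 'I_m * 'I_n => tix p.1 p.2)) //=.
apply: onW_bij; apply: inj_card_bij.
  by move=> [i j] [k l] /= /tix_inj[-> ->].
by rewrite card_prod !card_ord.
Qed.

Lemma matrix_tixP p (A B : 'M[K]_(m * n, p)) :
  (forall i j k, A (tix i j) k = B (tix i j) k) -> A = B.
Proof.
by move=> AB; apply/matrixP=> i k; have [i1 [i2 ->]] := tix_surj i.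
Qed.

End TensorIndex.

Section Tensor.

Variable K : fieldType.

(** [tprod] recurses on rows and [trow] on columns, so the entry formula takes one induction for
    each. *)
Lemma trow_tix n1 (A : 'rV[K]_n1) m2 n2 (B : 'M[K]_(m2, n2)) j k l :
  trow A B j (tix k l) = A 0 k * B j l.
Proof.
elim: n1 => [|n1 IHn] in A k *; first by case: k.
rewrite /= mxE; case: splitP => [l' e | l' e].
  have k0 : k = lshift n1 (@ord0 0).
    apply: val_inj => /=; apply/eqP; rewrite -leqn0 leqNgt; apply/negP => k_gt0.
    have := ltn_ord l'; rewrite -e /= ltnNge => /negP[].
    by rewrite (leq_trans _ (leq_addr _ _)) // leq_pmull.
  have -> : l = l' by apply: val_inj; rewrite /= -e k0 /=.
  by rewrite !mxE k0.
have k_gt0 : (0 < k)%N.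
  rewrite lt0n; apply/negP=> /eqP k0.
  have := ltn_ord l; rewrite ltnNge => /negP[].
  by rewrite -[X in (_ <= X)%N]add0n -(mul0n n2) -{1}k0 (e : (k * n2 + l)%N = _) leq_addr.
have ltk : (k.-1 < n1)%N by rewrite -ltnS prednK.
have -> : l' = tix (Ordinal ltk) l.
  apply: val_inj => /=; apply/eqP; rewrite -(eqn_add2l n2) -e /= addnA -mulSn.
  by rewrite prednK.
rewrite IHn mxE; congr (A _ _ * _); apply: val_inj => /=.
by rewrite add1n prednK.
Qed.

Lemma tprod_tix m1 n1 (A : 'M[K]_(m1, n1)) m2 n2 (B : 'M[K]_(m2, n2)) i j k l :
  tprod A B (tix i j) (tix k l) = A i k * B j l.
Proof.
elim: m1 => [|m1 IHm] in A i *; first by case: i.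
rewrite /= mxE; case: splitP => [j' e | j' e].
  have i0 : i = lshift m1 (@ord0 0).
    apply: val_inj => /=; apply/eqP; rewrite -leqn0 leqNgt; apply/negP => i_gt0.
    have := ltn_ord j'; rewrite -e /= ltnNge => /negP[].
    by rewrite (leq_trans _ (leq_addr _ _)) // leq_pmull.
  have -> : j = j' by apply: val_inj; rewrite /= -e i0 /=.
  by rewrite trow_tix mxE i0.
have i_gt0 : (0 < i)%N.
  rewrite lt0n; apply/negP=> /eqP i0.
  have := ltn_ord j; rewrite ltnNge => /negP[].
  by rewrite -[X in (_ <= X)%N]add0n -(mul0n m2) -{1}i0 (e : (i * m2 + j)%N = _) leq_addr.
have lti : (i.-1 < m1)%N by rewrite -ltnS prednK.
have -> : j' = tix (Ordinal lti) j.
  apply: val_inj => /=; apply/eqP; rewrite -(eqn_add2l m2) -e /= addnA -mulSn.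
  by rewrite prednK.
rewrite IHm mxE; congr (A _ _ * _); apply: val_inj => /=.
by rewrite add1n prednK.
Qed.

End Tensor.

Section OuterTensor.

Variables (K : fieldType) (gT hT : finGroupType).
Variables (G : {group gT}) (H : {group hT}).
Local Notation repX := (representation K G).
Local Notation repY := (representation K H).

(** Restricted to the second group, an outer tensor product is a sum of m copies of its second
    factor, and [comp1 i k E] is the block of [E] from copy i to copy k; [comp2] plays the same role
    for the first group. *)
Definition comp1 m n m' n' (i : 'I_m) (k : 'I_m') (E : 'M[K]_(m * n, m' * n')) :=
  \matrix_(j, l) E (tix i j) (tix k l).

Definition comp2 m n m' n' (j : 'I_n) (l : 'I_n') (E : 'M[K]_(m * n, m' * n')) :=
  \matrix_(i, k) E (tix i j) (tix k l).

Lemma comp1M m n m' n' m'' n'' (i : 'I_m) (k : 'I_m'')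
    (E : 'M[K]_(m * n, m' * n')) (F : 'M[K]_(m' * n', m'' * n'')) :
  comp1 i k (E *m F) = \sum_q comp1 i q E *m comp1 q k F.
Proof.
apply/matrixP=> j l; rewrite !mxE sum_tix summxE; apply: eq_bigr => q _.
by rewrite mxE; apply: eq_bigr => s _; rewrite !mxE.
Qed.

Lemma comp2M m n m' n' m'' n'' (j : 'I_n) (l : 'I_n'')
    (E : 'M[K]_(m * n, m' * n')) (F : 'M[K]_(m' * n', m'' * n'')) :
  comp2 j l (E *m F) = \sum_q comp2 j q E *m comp2 q l F.
Proof.
apply/matrixP=> i k; rewrite !mxE sum_tix summxE exchange_big.
by apply: eq_bigr => q _; rewrite mxE; apply: eq_bigr => s _; rewrite !mxE.
Qed.

Lemma comp1_1 m n (i k : 'I_m) : comp1 i k 1%:M = (i == k)%:R%:M :> 'M[K]_n.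
Proof.
apply/matrixP=> j l; rewrite !mxE.
have [<-|nik] := eqVneq i k.
  congr (_%:R); congr nat_of_bool; apply/eqP/eqP=> [/tix_inj[]|-> //] //.
rewrite mul0rn; case: eqP => // /tix_inj[e]; by rewrite e eqxx in nik.
Qed.

Lemma comp2_1 m n (j l : 'I_n) : comp2 j l 1%:M = (j == l)%:R%:M :> 'M[K]_m.
Proof.
apply/matrixP=> i k; rewrite !mxE.
have [<-|njl] := eqVneq j l.
  congr (_%:R); congr nat_of_bool; apply/eqP/eqP=> [/tix_inj[]|-> //] //.
rewrite mul0rn; case: eqP => // /tix_inj[_ e]; by rewrite e eqxx in njl.
Qed.

Lemma comp2_tprod1l m n m' n' (A : 'M[K]_n) (E : 'M[K]_(m * n, m' * n')) j l :
  comp2 j l (tprod 1%:M A *m E) = \sum_q A j q *: comp2 q l E.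
Proof.
apply/matrixP=> i k; rewrite !mxE sum_tix summxE exchange_big /=.
apply: eq_bigr => q _; rewrite (bigD1 i) //= big1 => [|s nsi].
  by rewrite !tprod_tix !mxE eqxx mul1r addr0.
by rewrite tprod_tix mxE eq_sym (negPf nsi) mul0r mul0r.
Qed.

Lemma comp2_tprod1r m n m' n' (A : 'M[K]_n') (E : 'M[K]_(m * n, m' * n')) j l :
  comp2 j l (E *m tprod 1%:M A) = \sum_q A q l *: comp2 j q E.
Proof.
apply/matrixP=> i k; rewrite !mxE sum_tix summxE exchange_big /=.
apply: eq_bigr => q _; rewrite (bigD1 k) //= big1 => [|s nsi].
  by rewrite !tprod_tix !mxE eqxx mul1r addr0 mulrC.
by rewrite tprod_tix mxE (negPf nsi) mul0r mulr0.
Qed.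

Lemma comp1_tprodl m n m' n' (A : 'M[K]_n) (E : 'M[K]_(m * n, m' * n')) i k :
  comp1 i k (tprod 1%:M A *m E) = A *m comp1 i k E.
Proof.
rewrite comp1M (bigD1 i) //= big1 => [|q nqi].
  rewrite addr0; congr (_ *m _); apply/matrixP=> j l.
  by rewrite mxE tprod_tix mxE eqxx mul1r.
rewrite [comp1 i q _](_ : _ = 0) ?mul0mx //; apply/matrixP=> j l.
by rewrite mxE tprod_tix !mxE eq_sym (negPf nqi) mul0r.
Qed.

Lemma comp1_tprodr m n m' n' (A : 'M[K]_n') (E : 'M[K]_(m * n, m' * n')) i k :
  comp1 i k (E *m tprod 1%:M A) = comp1 i k E *m A.
Proof.
rewrite comp1M (bigD1 k) //= big1 => [|q nqi].
  rewrite addr0; congr (_ *m _); apply/matrixP=> j l.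
  by rewrite mxE tprod_tix mxE eqxx mul1r.
rewrite [comp1 q k _](_ : _ = 0) ?mulmx0 //; apply/matrixP=> j l.
by rewrite mxE tprod_tix !mxE (negPf nqi) mul0r.
Qed.

Lemma comp2_tprodl m n m' n' (A : 'M[K]_m) (E : 'M[K]_(m * n, m' * n')) j l :
  comp2 j l (tprod A 1%:M *m E) = A *m comp2 j l E.
Proof.
rewrite comp2M (bigD1 j) //= big1 => [|q nqi].
  rewrite addr0; congr (_ *m _); apply/matrixP=> i k.
  by rewrite mxE tprod_tix mxE eqxx mulr1.
rewrite [comp2 j q _](_ : _ = 0) ?mul0mx //; apply/matrixP=> i k.
by rewrite mxE tprod_tix !mxE eq_sym (negPf nqi) mulr0.
Qed.

Lemma comp2_tprodr m n m' n' (A : 'M[K]_m') (E : 'M[K]_(m * n, m' * n')) j l :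
  comp2 j l (E *m tprod A 1%:M) = comp2 j l E *m A.
Proof.
rewrite comp2M (bigD1 l) //= big1 => [|q nqi].
  rewrite addr0; congr (_ *m _); apply/matrixP=> i k.
  by rewrite mxE tprod_tix mxE eqxx mulr1.
rewrite [comp2 q l _](_ : _ = 0) ?mulmx0 //; apply/matrixP=> i k.
by rewrite mxE tprod_tix !mxE (negPf nqi) mulr0.
Qed.

Section Homs.

Variables (m n m' n' : nat).
Variables (X : mx_representation K G m) (Y : mx_representation K H n).
Variables (X' : mx_representation K G m') (Y' : mx_representation K H n').
Local Notation XY := (outer_tensor X Y).
Local Notation XY' := (outer_tensor X' Y').

Lemma mxhom_tprod A B : mxhom X X' A -> mxhom Y Y' B -> mxhom XY XY' (tprod A B).
Proof.
move=> hA hB [x y]; rewrite inE /= => /andP[Gx Hy] /=.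
by rewrite -!tprodE hA ?hB.
Qed.

Lemma mxhom_tensorl E x : mxhom XY XY' E -> x \in G ->
  tprod (X x) 1%:M *m E = E *m tprod (X' x) 1%:M.
Proof.
move=> hE Gx; have := hE (x, 1%g); rewrite inE /= Gx group1 /= !repr_mx1; exact.
Qed.

Lemma mxhom_tensorr E y : mxhom XY XY' E -> y \in H ->
  tprod 1%:M (Y y) *m E = E *m tprod 1%:M (Y' y).
Proof.
move=> hE Hy; have := hE (1%g, y); rewrite inE /= Hy group1 /= !repr_mx1; exact.
Qed.

Lemma mxhom_comp1 E i k : mxhom XY XY' E -> mxhom Y Y' (comp1 i k E).
Proof.
by move=> hE y Hy; rewrite -comp1_tprodl -comp1_tprodr (mxhom_tensorr hE).
Qed.

Lemma mxhom_comp2 E j l : mxhom XY XY' E -> mxhom X X' (comp2 j l E).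
Proof.
by move=> hE x Gx; rewrite -comp2_tprodl -comp2_tprodr (mxhom_tensorl hE).
Qed.

End Homs.

Lemma rsim_tensor m n m' n' (X : mx_representation K G m)
    (Y : mx_representation K H n) (X' : mx_representation K G m')
    (Y' : mx_representation K H n') :
  mx_rsim X X' -> mx_rsim Y Y' -> mx_rsim (outer_tensor X Y) (outer_tensor X' Y').
Proof.
move=> /rsimP[A [B [hA hB AB BA]]] /rsimP[C [D [hC hD CD DC]]].
apply/rsimP; exists (tprod A C), (tprod B D).
by split; rewrite -?tprodE ?AB ?CD ?BA ?DC ?tprod1 //; apply: mxhom_tprod.
Qed.

(** Restricted to G, the two modules are sums of copies of X and of X'. A diagonal block of E F = 1
    writes the identity of X as a sum of maps through X', one of which is invertible since X is
    local. *)
Lemma rsim_tensorl m n m' n' (X : mx_representation K G m)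
    (Y : mx_representation K H n) (X' : mx_representation K G m')
    (Y' : mx_representation K H n') :
  (0 < n)%N -> local_repr X -> mx_indecomposable X' ->
  mx_rsim (outer_tensor X Y) (outer_tensor X' Y') -> mx_rsim X X'.
Proof.
case: n Y => // n Y _ locX indX' /rsimP[E [F [hE hF EF _]]].
have := unitmx1 K m; rewrite -[1%:M]/((ord0 == ord0 :> 'I_n.+1)%:R%:M).
rewrite -comp2_1 -EF comp2M => /(local_unit_sum locX)[q _|q [_ _ uq]].
  exact: mxhomM (mxhom_comp2 _ _ hE) (mxhom_comp2 _ _ hF).
apply: summand_local_rsim => //.
exact: summand_unit (mxhom_comp2 _ _ hE) (mxhom_comp2 _ _ hF) uq.
Qed.

Lemma rsim_tensorr m n m' n' (X : mx_representation K G m)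
    (Y : mx_representation K H n) (X' : mx_representation K G m')
    (Y' : mx_representation K H n') :
  (0 < m)%N -> local_repr Y -> mx_indecomposable Y' ->
  mx_rsim (outer_tensor X Y) (outer_tensor X' Y') -> mx_rsim Y Y'.
Proof.
case: m X => // m X _ locY indY' /rsimP[E [F [hE hF EF _]]].
have := unitmx1 K n; rewrite -[1%:M]/((ord0 == ord0 :> 'I_m.+1)%:R%:M).
rewrite -comp1_1 -EF comp1M => /(local_unit_sum locY)[q _|q [_ _ uq]].
  exact: mxhomM (mxhom_comp1 _ _ hE) (mxhom_comp1 _ _ hF).
apply: summand_local_rsim => //.
exact: summand_unit (mxhom_comp1 _ _ hE) (mxhom_comp1 _ _ hF) uq.
Qed.

(* In a local module with this property the endomorphisms killing v form the  *)
(* radical of the endomorphism ring, and its residue field is K.              *)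
Definition End_eigenvector (gT' : finGroupType) (G' : {group gT'}) m
    (X : mx_representation K G' m) (v : 'rV[K]_m) :=
  v != 0 /\ forall A, mxhom X X A -> exists c, v *m A = c *: v.

Lemma local_unit_sub m (X : mx_representation K G m) (v : 'rV[K]_m) A :
  local_repr X -> v != 0 -> mxhom X X A -> v *m A = 0 -> 1%:M - A \in unitmx.
Proof.
move=> [_ locX] v0 hA vA; case/orP: (locX A hA) => // uA.
by rewrite -(mulmxK uA v) vA mul0mx eqxx in v0.
Qed.

(** A Nakayama argument: the entries of g lie in the radical of End(X), so 1 - g is invertible as a
    matrix over End(X). The last coordinate is eliminated by inverting 1 minus its diagonal entry;
    the new coefficients still kill [v]. *)
Lemma radical_fixpoint_eq0 m (X : mx_representation K G m) (v : 'rV[K]_m) n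
    (x : 'I_n -> 'rV[K]_m) (g : 'I_n -> 'I_n -> 'M[K]_m) :
    local_repr X -> v != 0 ->
    (forall j l, mxhom X X (g j l)) -> (forall j l, v *m g j l = 0) ->
    (forall l, x l = \sum_j x j *m g j l) ->
  forall l, x l = 0.
Proof.
move=> locX v0; elim: n => [|n IHn] in x g * => hg vg xg l; first by case: l.
pose w (i : 'I_n) : 'I_n.+1 := widen_ord (leqnSn n) i.
have u := local_unit_sub locX v0 (hg ord_max ord_max) (vg _ _).
set a := 1%:M - _ in u.
have ha : mxhom X X (invmx a) by apply: mxhomV u; apply: mxhomB; [apply: mxhom1|].
have xmax : x ord_max = \sum_i x (w i) *m g (w i) ord_max *m invmx a.
  rewrite -mulmx_suml; apply: (canRL (mulmxK u)).
  by rewrite mulmxBr mulmx1 {1}xg big_ord_recr /= addrK.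
have x0 i : x (w i) = 0.
  apply: (IHn (x \o w) (fun j l => g (w j) (w l)
      + g (w j) ord_max *m invmx a *m g ord_max (w l))) => [j l'|j l'|l'] /=.
  - exact: mxhomD (mxhomM (mxhomM _ ha) _).
  - by rewrite mulmxDr !mulmxA !vg !mul0mx addr0.
  - rewrite xg big_ord_recr /= xmax mulmx_suml -big_split /=.
    by apply: eq_bigr => j _; rewrite mulmxDr !mulmxA.
have xm0 : x ord_max = 0.
  by rewrite xmax big1 // => i _; rewrite x0 !mul0mx.
case: (unliftP ord_max l) => [i ->|-> //].
by rewrite -(x0 i); congr (x _); apply: val_inj; rewrite /= /bump leqNgt ltn_ord.
Qed.

(** Replacing each component of an idempotent E by its eigenvalue on [v] reduces E modulo the
    radical of End(X) to an idempotent of End(Y), which is 0 or 1. Then E or 1 - E is an idempotent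
    with all components in the radical, hence zero. *)
Lemma tensor_indecomposable m n (X : mx_representation K G m)
    (Y : mx_representation K H n) v :
    mx_indecomposable X -> End_eigenvector X v -> mx_indecomposable Y ->
  mx_indecomposable (outer_tensor X Y).
Proof.
move=> indX [v0 eigv] indY; have locX := indecomposable_local indX.
have idem0 E : mxhom (outer_tensor X Y) (outer_tensor X Y) E -> E *m E = E ->
    (forall j l, v *m comp2 j l E = 0) -> E = 0.
  move=> hE EE vE; apply: matrix_tixP => i0 j0 k.
  have [k1 [k2 ->]] := tix_surj k; rewrite [RHS]mxE.
  (* One row of E, cut according to the second column index; E E = E makes it a fixed point of the
     components of E. *)
  pose x l : 'rV_m := \row_k E (tix i0 j0) (tix k l).
  have := radical_fixpoint_eq0 locX v0 (fun j l => mxhom_comp2 j l hE) vE.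
  move=> /(_ x) x0; suff xE l : x l = \sum_j x j *m comp2 j l E.
    by have /rowP/(_ k1) := x0 xE k2; rewrite !mxE.
  rewrite {1}/x -{1}EE; apply/rowP=> k'; rewrite !mxE summxE sum_tix.
  rewrite exchange_big; apply: eq_bigr => j _; rewrite mxE.
  by apply: eq_bigr => i _; rewrite !mxE.
have [k0 vk0] : exists k0, v 0 k0 != 0.
  apply/existsP; apply: contraNT v0; rewrite negb_exists => /forallP v0'.
  by apply/eqP/rowP=> k; rewrite mxE; apply/eqP; have := v0' k; rewrite negbK.
(* Reading the eigenvalue off a nonzero coordinate of [v] defines [res] on all matrices and makes it
   linear at once; only multiplicativity needs the eigenvector property. *)
pose res (A : 'M[K]_m) : K := (v *m A) 0 k0 / v 0 k0.
have resP A : mxhom X X A -> v *m A = res A *: v.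
  by move=> hA; have [c e] := eigv _ hA; rewrite /res e mxE mulfK.
have resM A B : mxhom X X A -> mxhom X X B -> res (A *m B) = res A * res B.
  by move=> hA hB; rewrite {1}/res mulmxA resP // -scalemxAl mxE -mulrA.
have res_sum (I : finType) (a : I -> K) (A : I -> 'M_m) :
    res (\sum_i a i *: A i) = \sum_i a i * res (A i).
  rewrite /res mulmx_sumr summxE mulr_suml; apply: eq_bigr => i _.
  by rewrite -scalemxAr mxE mulrA.
apply: idem_indecomposable => [|E hE EE].
  by rewrite muln_gt0; case: indX => -> _; case: indY.
pose Ebar := \matrix_(j, l) res (comp2 j l E).
have hEbar : mxhom Y Y Ebar.
  move=> y Hy; apply/matrixP=> j l; rewrite !mxE.
  transitivity (res (comp2 j l (tprod 1%:M (Y y) *m E))).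
    by rewrite comp2_tprod1l res_sum; apply: eq_bigr => q _; rewrite mxE.
  rewrite (mxhom_tensorr hE Hy) comp2_tprod1r res_sum.
  by apply: eq_bigr => q _; rewrite mxE mulrC.
have EEbar : Ebar *m Ebar = Ebar.
  apply/matrixP=> j l; rewrite [RHS]mxE -EE comp2M !mxE.
  under [X in _ = res X]eq_bigr => q _ do rewrite -[_ *m _]scale1r.
  rewrite res_sum; apply: eq_bigr => q _; rewrite !mxE mul1r resM //.
    exact: mxhom_comp2 hE.
  exact: mxhom_comp2 hE.
have [Ebar0 | Ebar1] := indecomposable_idem indY hEbar EEbar; [left | right].
  apply: idem0 => // j l; rewrite resP; last exact: mxhom_comp2 hE.
  by have /matrixP/(_ j l) := Ebar0; rewrite !mxE => ->; rewrite scale0r.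
apply/esym/eqP; rewrite -subr_eq0; apply/eqP; apply: idem0.
- exact: mxhomB (@mxhom1 _ _ _ _ _) hE.
- by rewrite mulmxBl mul1mx mulmxBr mulmx1 EE subrr subr0.
move=> j l; have -> : comp2 j l (1%:M - E) = comp2 j l 1%:M - comp2 j l E.
  by apply/matrixP=> i k; rewrite !mxE.
rewrite mulmxBr (resP (comp2 j l E)); last exact: mxhom_comp2 hE.
have /matrixP/(_ j l) := Ebar1; rewrite mxE => ->.
by rewrite comp2_1 mul_mx_scalar mxE subrr.
Qed.

Lemma tprodDl m1 n1 m2 n2 (A A' : 'M[K]_(m1, n1)) (B : 'M[K]_(m2, n2)) :
  tprod (A + A') B = tprod A B + tprod A' B.
Proof.
apply: matrix_tixP => i j k; have [k1 [k2 ->]] := tix_surj k.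
by rewrite mxE !tprod_tix mxE mulrDl.
Qed.

Lemma tprodDr m1 n1 m2 n2 (A : 'M[K]_(m1, n1)) (B B' : 'M[K]_(m2, n2)) :
  tprod A (B + B') = tprod A B + tprod A B'.
Proof.
apply: matrix_tixP => i j k; have [k1 [k2 ->]] := tix_surj k.
by rewrite mxE !tprod_tix mxE mulrDr.
Qed.

Lemma tprod0l m1 n1 m2 n2 (B : 'M[K]_(m2, n2)) :
  tprod (0 : 'M[K]_(m1, n1)) B = 0.
Proof. by apply: (addIr (tprod 0 B)); rewrite -tprodDl !add0r. Qed.

Lemma tprod0r m1 n1 m2 n2 (A : 'M[K]_(m1, n1)) :
  tprod A (0 : 'M[K]_(m2, n2)) = 0.
Proof. by apply: (addIr (tprod A 0)); rewrite -tprodDr !add0r. Qed.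

Definition rep_tensor (X : repX) (Y : repY) : representation K (setX_group G H) :=
  Representation (outer_tensor X Y).

Lemma rsim_tensor_daddl (X1 X2 : repX) (Y : repY) :
  mx_rsim (rep_tensor (dadd_grepr X1 X2) Y)
    (dadd_grepr (rep_tensor X1 Y) (rep_tensor X2 Y)).
Proof.
(* The injections and projections of the direct sum intertwine because they are blocks of the
   identity. *)
have [hr1 hr2] := (@mxhom_lr _ _ _ _ _ _ _ _ (@mxhom1 _ _ _ _ (dadd_grepr X1 X2))).
have [hc1 hc2] := (@mxhom_ud _ _ _ _ _ _ _ _ (@mxhom1 _ _ _ _ (dadd_grepr X1 X2))).
have h1 := @mxhom1 _ _ _ _ Y.
move: hr1 hr2 hc1 hc2; rewrite scalar_mx_block block_mxEh row_mxKl row_mxKr.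
rewrite -block_mxEh block_mxEv col_mxKu col_mxKd => hr1 hr2 hc1 hc2.
apply/rsimP.
exists (row_mx (tprod (col_mx 1%:M 0) 1%:M) (tprod (col_mx 0 1%:M) 1%:M)).
exists (col_mx (tprod (row_mx 1%:M 0) 1%:M) (tprod (row_mx 0 1%:M) 1%:M)).
split.
- by apply/mxhom_row; split; apply: mxhom_tprod.
- by apply/mxhom_col; split; apply: mxhom_tprod.
- rewrite mul_row_col -!tprodE !mul_col_row !(mulmx0, mulmx1, mul0mx) -tprodDl.
  by rewrite add_block_mx !(addr0, add0r) -scalar_mx_block tprod1.
- rewrite mul_col_row -!tprodE !mul_row_col !(mulmx0, mulmx1, mul0mx, addr0, add0r).
  by rewrite !tprod1 !tprod0l -scalar_mx_block.
Qed.

Lemma rsim_tensor_daddr (X : repX) (Y1 Y2 : repY) :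
  mx_rsim (rep_tensor X (dadd_grepr Y1 Y2))
    (dadd_grepr (rep_tensor X Y1) (rep_tensor X Y2)).
Proof.
have [hr1 hr2] := (@mxhom_lr _ _ _ _ _ _ _ _ (@mxhom1 _ _ _ _ (dadd_grepr Y1 Y2))).
have [hc1 hc2] := (@mxhom_ud _ _ _ _ _ _ _ _ (@mxhom1 _ _ _ _ (dadd_grepr Y1 Y2))).
have h1 := @mxhom1 _ _ _ _ X.
move: hr1 hr2 hc1 hc2; rewrite scalar_mx_block block_mxEh row_mxKl row_mxKr.
rewrite -block_mxEh block_mxEv col_mxKu col_mxKd => hr1 hr2 hc1 hc2.
apply/rsimP.
exists (row_mx (tprod 1%:M (col_mx 1%:M 0)) (tprod 1%:M (col_mx 0 1%:M))).
exists (col_mx (tprod 1%:M (row_mx 1%:M 0)) (tprod 1%:M (row_mx 0 1%:M))).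
split.
- by apply/mxhom_row; split; apply: mxhom_tprod.
- by apply/mxhom_col; split; apply: mxhom_tprod.
- rewrite mul_row_col -!tprodE !mul_col_row !(mulmx0, mulmx1, mul0mx) -tprodDr.
  by rewrite add_block_mx !(addr0, add0r) -scalar_mx_block tprod1.
- rewrite mul_col_row -!tprodE !mul_row_col !(mulmx0, mulmx1, mul0mx, addr0, add0r).
  by rewrite !tprod1 !tprod0r -scalar_mx_block.
Qed.

Lemma rsim_degree0 (gT' : finGroupType) (G' : {group gT'})
    (r : representation K G') : rdegree r = 0%N -> mx_rsim r grepr0.
Proof.
case: r => n r /= n0; case: _ / (esym n0) r => r.
exists 0 => // [|x _]; last by rewrite mulmx0 mul0mx.
by rewrite /row_free mxrank0.
Qed.

Lemma rsim_tensor_dsum (s : seq repX) (t : seq repY) :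
  mx_rsim (rep_tensor (\big[dadd_grepr/grepr0]_(r <- s) r)
                      (\big[dadd_grepr/grepr0]_(r <- t) r))
    (\big[dadd_grepr/grepr0]_(r <- [seq rep_tensor X Y | X <- s, Y <- t]) r).
Proof.
elim: s => [|X s IHs].
  by rewrite !big_nil; apply: rsim_degree0.
rewrite big_cons [flatten _]/=; apply: mx_rsim_trans (rsim_tensor_daddl _ _ _) _.
apply: mx_rsim_trans (mx_rsim_sym (rsim_dsum_cat _ _)).
apply: rsim_dadd IHs; elim: t => [|Y t IHt].
  by rewrite !big_nil; apply: rsim_degree0; rewrite /= muln0.
rewrite [map _ _]/=.
rewrite !big_cons; apply: mx_rsim_trans (rsim_tensor_daddr _ _ _) _.
exact: rsim_dadd (mx_rsim_refl _) IHt.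
Qed.

End OuterTensor.

(** * The Schur algebra on words *)

Section PermutationHoms.

Variables (K : fieldType) (gT : finGroupType).

Definition fun_mx (T1 T2 : finType) (F : T1 -> T2 -> K) : 'M_(#|T1|, #|T2|) :=
  \matrix_(i, j) F (enum_val i) (enum_val j).

Lemma fun_mxE (T1 T2 : finType) (F : T1 -> T2 -> K) x y :
  fun_mx F (enum_rank x) (enum_rank y) = F x y.
Proof. by rewrite mxE !enum_rankK. Qed.

Lemma fun_mxP (T1 T2 : finType) (A B : 'M[K]_(#|T1|, #|T2|)) :
  (forall (x : T1) (y : T2),
     A (enum_rank x) (enum_rank y) = B (enum_rank x) (enum_rank y)) -> A = B.
Proof.
by move=> AB; apply/matrixP=> i j; rewrite -(enum_valK i) -(enum_valK j).
Qed.

Lemma sum_rank (V : nmodType) (T : finType) (F : 'I_#|T| -> V) :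
  \sum_i F i = \sum_x F (enum_rank x).
Proof.
rewrite (reindex (@enum_rank T)) //.
by exists enum_val => x _; rewrite ?enum_rankK ?enum_valK.
Qed.

Lemma fun_mxM (T1 T2 T3 : finType) (F : T1 -> T2 -> K) (H : T2 -> T3 -> K) :
  fun_mx F *m fun_mx H = fun_mx (fun x z => \sum_y F x y * H y z).
Proof.
apply: fun_mxP => x z; rewrite mxE fun_mxE sum_rank.
by apply: eq_bigr => y _; rewrite !fun_mxE.
Qed.

Variables (T1 T2 : finType) (to1 : {action gT &-> T1}) (to2 : {action gT &-> T2}).

Lemma perm_repE (T : finType) (to : {action gT &-> T}) g :
  perm_rep K to g = fun_mx (fun x y => (to x g == y)%:R).
Proof.
apply: fun_mxP => x y; rewrite fun_mxE !mxE enum_rankK eqxx /=.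
by rewrite eq_sym (inj_eq enum_rank_inj).
Qed.

Lemma perm_homP (A : 'M_(#|T1|, #|T2|)) :
  mxhom (perm_rep K to1) (perm_rep K to2) A <->
  forall x y g, A (enum_rank (to1 x g)) (enum_rank (to2 y g)) =
                A (enum_rank x) (enum_rank y).
Proof.
have eL g x y : (perm_rep K to1 g *m A) (enum_rank x) (enum_rank y)
    = A (enum_rank (to1 x g)) (enum_rank y).
  rewrite perm_repE mxE sum_rank (bigD1 (to1 x g)) //= big1 => [|z nz].
    by rewrite fun_mxE eqxx mul1r addr0.
  by rewrite fun_mxE eq_sym (negPf nz) mul0r.
have eR g x y : (A *m perm_rep K to2 g) (enum_rank x) (enum_rank (to2 y g))
    = A (enum_rank x) (enum_rank y).
  rewrite perm_repE mxE sum_rank (bigD1 y) //= big1 => [|z nz].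
    by rewrite fun_mxE eqxx mulr1 addr0.
  by rewrite fun_mxE (inj_eq (act_inj to2 g)) (negPf nz) mulr0.
split=> [hA x y g | hA g _].
  by rewrite -eL hA ?inE // eR.
apply: fun_mxP => x y; rewrite eL -(actKV to2 g y) eR.
by rewrite -[in LHS](actKV to2 g y) hA actKV.
Qed.

End PermutationHoms.

(** * Words, their contents and the orbits of pairs of words *)

Section Words.

Variable n : nat.

(* A word f encodes the tabloid, of a shape that need not be a partition,     *)
(* whose row i is f^-1(i).                                                    *)
Definition word : finType := {ffun 'I_n -> 'I_n}.

(** The inverse makes this a right action and matches the action on tabloids: [s] moves the letter
    at x to the position s x. *)
Definition word_act (f : word) (s : 'S_n) : word := [ffun x => f (s^-1%g x)].

Lemma word_act1 f : word_act f 1 = f.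
Proof. by apply/ffunP=> x; rewrite ffunE invg1 perm1. Qed.

Lemma word_actM f : act_morph word_act f.
Proof. by move=> s t; apply/ffunP=> x; rewrite !ffunE invMg permM. Qed.

Canonical word_action := TotalAction word_act1 word_actM.

Definition content (f : word) : {ffun 'I_n -> nat} :=
  [ffun i => (\sum_x (f x == i))%N].

(** The matrix of intersection sizes of row i of f with row j of g, the classical parameter of a
    double coset of Young subgroups: it determines the orbit of the pair. *)
Definition paircount (f g : word) : {ffun 'I_n * 'I_n -> nat} :=
  [ffun p => (\sum_x ((f x == p.1) && (g x == p.2)))%N].

Lemma contentE f i : content f i = (\sum_x (f x == i))%N.
Proof. exact: ffunE. Qed.

Lemma paircountE f g i j :
  paircount f g (i, j) = (\sum_x ((f x == i) && (g x == j)))%N.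
Proof. exact: ffunE. Qed.

Definition psum (k : {ffun 'I_n -> nat}) (m : nat) := (\sum_(i < n) (i < m) * k i)%N.

Definition comp_dom (k l : {ffun 'I_n -> nat}) := forall m, (psum l m <= psum k m)%N.

(** The sum of all partial sums is monotone for dominance, so strict dominance becomes an inequality
    of integers and supports induction. *)
Definition comp_weight (k : {ffun 'I_n -> nat}) := (\sum_(m < n.+1) psum k m)%N.

Definition comp_sdom k l := comp_dom k l /\ (comp_weight l < comp_weight k)%N.

Lemma comp_dom_refl k : comp_dom k k.
Proof. by move=> m. Qed.

Lemma comp_dom_trans k1 k2 k3 : comp_dom k1 k2 -> comp_dom k2 k3 -> comp_dom k1 k3.
Proof. by move=> d12 d23 m; apply: leq_trans (d23 m) (d12 m). Qed.

Lemma comp_weight_le k l : comp_dom k l -> (comp_weight l <= comp_weight k)%N.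
Proof. by move=> d; apply: leq_sum => m _. Qed.

Lemma comp_sdomN k l : comp_sdom k l -> ~ comp_dom l k.
Proof. by move=> [_ lt] /comp_weight_le; rewrite leqNgt lt. Qed.

Lemma comp_sdomP k l m : (m <= n)%N -> comp_dom k l ->
  (psum l m < psum k m)%N -> comp_sdom k l.
Proof.
rewrite -ltnS => lem d lt; split=> //; rewrite /comp_weight.
rewrite (bigD1 (Ordinal lem)) //= [X in (_ < X)%N](bigD1 (Ordinal lem)) //=.
by rewrite -addSn leq_add // leq_sum.
Qed.

Lemma psum_content f m : psum (content f) m = (\sum_x (f x < m))%N.
Proof.
rewrite /psum; under [LHS]eq_bigr => i _ do rewrite contentE big_distrr /=.
rewrite exchange_big; apply: eq_bigr => x _.
rewrite (bigD1 (f x)) //= eqxx muln1 big1 ?addn0 // => i nfi.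
by rewrite eq_sym (negPf nfi) muln0.
Qed.

Lemma paircount_suml f g i : (\sum_j paircount f g (i, j) = content f i)%N.
Proof.
under eq_bigr => j _ do rewrite paircountE.
rewrite exchange_big contentE; apply: eq_bigr => x _ /=.
rewrite (bigD1 (g x)) //= eqxx andbT big1 ?addn0 // => j ngj.
by rewrite [_ == j]eq_sym (negPf ngj) andbF.
Qed.

Lemma paircount_sumr f g j : (\sum_i paircount f g (i, j) = content g j)%N.
Proof.
under eq_bigr => i _ do rewrite paircountE.
rewrite exchange_big contentE; apply: eq_bigr => x _ /=.
rewrite (bigD1 (f x)) //= eqxx big1 ?addn0 // => i nfi.
by rewrite [_ == i]eq_sym (negPf nfi).
Qed.

Lemma content_act f s : content (word_act f s) = content f.
Proof.
apply/ffunP=> i; rewrite !ffunE (reindex_inj (@perm_inj _ s)) /=.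
by apply: eq_bigr => x _; rewrite ffunE permK.
Qed.

Lemma paircount_act f g s :
  paircount (word_act f s) (word_act g s) = paircount f g.
Proof.
apply/ffunP=> p; rewrite !ffunE (reindex_inj (@perm_inj _ s)) /=.
by apply: eq_bigr => x _; rewrite !ffunE permK.
Qed.

Lemma paircount_orbit f g f' g' : paircount f g = paircount f' g' ->
  exists s, f' = word_act f s /\ g' = word_act g s.
Proof.
(* Equal pair counts say that the two sequences of letter pairs are equal as multisets, hence differ
   by a permutation of positions. *)
move=> e; pose t (h k : word) := [tuple (h x, k x) | x < n].
have /tuple_permP[s def_s] : perm_eq (t f' g') (t f g).
  apply/allP=> p _ /=.
  have cnt h k : count_mem p (t h k) = paircount h k p.
    rewrite -sum1_count big_map big_enum_cond /= ffunE big_mkcond.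
    by apply: eq_bigr => x _; rewrite /= -pair_eqE.
  by rewrite !cnt e.
have st x : (f' x, g' x) = (f (s x), g (s x)).
  have := congr1 (fun u => nth (f' x, g' x) u x) def_s.
  by rewrite !(@nth_mktuple _ _ _ _ x) tnth_mktuple.
exists s^-1%g; split; apply/ffunP=> x; rewrite ffunE invgK.
  by case: (st x).
by case: (st x).
Qed.

Lemma paircount_diag_eq f g :
  (forall i, paircount f g (i, i) = content f i) -> f = g.
Proof.
move=> e; apply/ffunP=> x; have := e (f x); rewrite !ffunE => /eqP.
rewrite (bigD1 x) //= [X in _ == X](bigD1 x) //= eqxx /=.
have le : (\sum_(y | y != x) ((f y == f x) && (g y == f x))
    <= \sum_(y | y != x) (f y == f x))%N.
  by apply: leq_sum => y _; case: (f y == f x) => //=; case: (g y == f x).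
have [-> // | _] := eqVneq (g x) (f x); rewrite add0n add1n => /eqP e'.
by rewrite e' ltnn in le.
Qed.

Lemma paircount_diag f i j :
  paircount f f (i, j) = ((i == j) * content f i)%N.
Proof.
rewrite !ffunE big_distrr; apply: eq_bigr => x _ /=.
have [->|] := eqVneq (f x) i; first by rewrite muln1.
by rewrite muln0.
Qed.

(** Changing letters i of f into r moves [t c] from row i to row r of column c in the pair matrix
    with g. The additive form avoids truncated subtraction. *)
Lemma paircount_move (f h g : word) i r :
    i != r -> (forall x, h x = f x \/ f x = i /\ h x = r) ->
  let t c := (\sum_x [&& f x == i, h x == r & g x == c])%N in
  forall a c, (paircount f g (a, c) + (a == r) * t c
             = paircount h g (a, c) + (a == i) * t c)%N.
Proof.
move=> nir fh t a c; rewrite !ffunE /= !big_distrr -!big_split /=.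
apply: eq_bigr => x _; have [-> | [-> ->]] := fh x.
  have [->|] := eqVneq (f x) i; last by rewrite !muln0.
  by rewrite (negPf nir) !muln0.
rewrite !eqxx /= [r == a]eq_sym [i == a]eq_sym.
by case: (a == i); case: (a == r); case: (g x == c).
Qed.

End Words.

(** * Endomorphisms of the word module are triangular for dominance *)

Section SchurAlgebra.

Variables (K : fieldType) (n : nat).
Local Notation word := (word n).
Local Notation rW := (perm_rep K (word_action n)).
Local Notation "''M_W'" := 'M[K]_#|word| (at level 8).

Definition wproj (k : {ffun 'I_n -> nat}) : 'M_W :=
  fun_mx (fun f g : word => ((f == g) && (content f == k))%:R).

(** For p a pair matrix, this is an element of Schur's basis of the endomorphism algebra: the 0-1
    matrix of one orbit on pairs of words. *)
Definition theta (p : {ffun 'I_n * 'I_n -> nat}) : 'M_W :=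
  fun_mx (fun f g : word => (paircount f g == p)%:R).

(** The two-sided ideal generated by the projectors of contents strictly dominating [k], with the
    factorisations kept explicit so that locality can later select one of them. *)
Inductive above (k : {ffun 'I_n -> nat}) : 'M_W -> Prop :=
| Above0 : above k 0
| AboveD l A B C : comp_sdom l k -> mxhom rW rW A -> mxhom rW rW B -> above k C ->
    above k (A *m wproj l *m B + C).

Lemma mxhom_wproj k : mxhom rW rW (wproj k).
Proof.
apply/perm_homP=> f g s; rewrite !fun_mxE content_act.
by rewrite (inj_eq (act_inj (word_action n) s)).
Qed.

Lemma mxhom_theta p : mxhom rW rW (theta p).
Proof. by apply/perm_homP=> f g s; rewrite !fun_mxE paircount_act. Qed.

Lemma wprojMl k A (f g : word) : (wproj k *m A) (enum_rank f) (enum_rank g)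
  = (content f == k)%:R * A (enum_rank f) (enum_rank g).
Proof.
rewrite mxE sum_rank (bigD1 f) //= big1 => [|h nhf].
  by rewrite fun_mxE eqxx addr0.
by rewrite fun_mxE eq_sym (negPf nhf) mul0r.
Qed.

Lemma wprojMr k A (f g : word) : (A *m wproj k) (enum_rank f) (enum_rank g)
  = A (enum_rank f) (enum_rank g) * (content g == k)%:R.
Proof.
rewrite mxE sum_rank (bigD1 g) //= big1 => [|h nhf].
  by rewrite fun_mxE eqxx addr0.
by rewrite fun_mxE (negPf nhf) mulr0.
Qed.

Lemma aboveDr k A B : above k A -> above k B -> above k (A + B).
Proof.
move=> aA aB; elim: aA => [|l C D E lk hC hD _ IH]; first by rewrite add0r.
by rewrite -addrA; apply: AboveD.
Qed.

Lemma aboveZ k c A : above k A -> above k (c *: A).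
Proof.
elim=> [|l C D E lk hC hD _ IH]; first by rewrite scaler0; apply: Above0.
rewrite scalerDr -!mulmxA scalemxAl mulmxA.
by apply: AboveD => //; apply: mxhomZ.
Qed.

Definition triangular k A := exists c, above k (A - c *: wproj k).

Lemma triangularD k A B : triangular k A -> triangular k B -> triangular k (A + B).
Proof.
move=> [c hc] [d hd]; exists (c + d).
by rewrite scalerDl opprD addrACA; apply: aboveDr.
Qed.

Lemma triangularZ k a A : triangular k A -> triangular k (a *: A).
Proof.
move=> [c hc]; exists (a * c).
by rewrite -scalerA -scalerBr; apply: aboveZ.
Qed.

Lemma triangular0 k : triangular k 0.
Proof. by exists 0; rewrite scale0r subr0; apply: Above0. Qed.

Lemma triangularB k A B : triangular k A -> triangular k B -> triangular k (A - B).
Proof. by move=> tA tB; rewrite -scaleN1r; apply/triangularD/triangularZ. Qed.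

(* An endomorphism is a combination of the orbit sums theta in its support.   *)
Lemma triangular_support k A : mxhom rW rW A ->
    (forall f g : word, A (enum_rank f) (enum_rank g) != 0 ->
       triangular k (theta (paircount f g))) ->
  triangular k A.
Proof.
pose supp (A : 'M_W) := [set p : word * word | A (enum_rank p.1) (enum_rank p.2) != 0].
have [m] := ubnP #|supp A|; elim: m A => // m IHm A ltm hA tA.
have [s0 | [[f g]]] := set_0Vmem (supp A).
  suff -> : A = 0 by apply: triangular0.
  apply: fun_mxP => f g; rewrite mxE; apply/eqP.
  by have /setP/(_ (f, g)) := s0; rewrite !inE => /negbFE.
rewrite inE /= => Afg; set a := A _ _ in Afg.
rewrite -(subrK (a *: theta (paircount f g)) A).
apply: triangularD; last exact/triangularZ/tA.
have supp' (f' g' : word) : (A - a *: theta (paircount f g)) (enum_rank f') (enum_rank g')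
    = A (enum_rank f') (enum_rank g') * (paircount f' g' != paircount f g)%:R.
  rewrite 2!mxE mxE fun_mxE; case: eqP => [/esym/paircount_orbit[s [-> ->]] | _].
    by have /perm_homP -> := hA; rewrite mulr1 mulr0 subrr.
  by rewrite mulr0 subr0 mulr1.
apply: IHm => [||f' g'].
- rewrite -ltnS; apply: leq_trans ltm; rewrite ltnS; apply: proper_card.
  apply/properP; split.
    apply/subsetP=> [[f' g']]; rewrite !inE /= supp'.
    by apply: contraNneq => ->; rewrite mul0r.
  by exists (f, g); rewrite !inE //= supp' eqxx mulr0 eqxx.
- exact: mxhomB hA (mxhomZ _ (mxhom_theta _)).
- rewrite supp' => nz; apply: tA; apply: contraNneq nz => ->; by rewrite mul0r.
Qed.

Lemma theta_diag f : theta (paircount f f) = wproj (content f).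
Proof.
apply: fun_mxP => g h; rewrite !fun_mxE; congr (_%:R); congr nat_of_bool.
apply/eqP/andP=> [e | [/eqP <- /eqP e]]; last first.
  by apply/ffunP=> [[i j]]; rewrite !paircount_diag e.
have cg : content g = content f.
  by apply/ffunP=> i; rewrite -(paircount_suml g h) e paircount_suml.
split; last exact/eqP.
apply/eqP/paircount_diag_eq => i.
by rewrite e paircount_diag eqxx mul1n cg.
Qed.

Lemma theta_mul f h g : theta (paircount f h) *m theta (paircount h g)
  = theta (paircount f h) *m wproj (content h) *m theta (paircount h g).
Proof.
congr (_ *m _); apply: fun_mxP => f' h'; rewrite wprojMr !fun_mxE.
case: eqP => [e|]; last by rewrite mul0r.
have -> : content h' = content h.
  by apply/ffunP=> i; rewrite -(paircount_sumr f' h') e paircount_sumr.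
by rewrite eqxx mulr1.
Qed.

Section Straightening.

Variables (f0 g0 : word) (i r : 'I_n).
Hypothesis lt_ri : (r < i)%N.

(* Up to orbit sums with a larger (r, r) entry, the orbit sum of (f0, g0) is  *)
(* the product of those of (f0, straight) and (straight, g0).                 *)
Definition straight : word :=
  [ffun x => if (f0 x == i) && (g0 x == r) then r else f0 x].
Local Notation h0 := straight.

Lemma straight_neq : i != r.
Proof. by rewrite -val_eqE /= gtn_eqF. Qed.

Lemma straight_move x : h0 x = f0 x \/ f0 x = i /\ h0 x = r.
Proof. by rewrite ffunE; case: andP => [[/eqP -> _]|]; [right | left]. Qed.

Lemma paircount_straight : paircount f0 h0 (i, r) = paircount f0 g0 (i, r).
Proof.
rewrite !paircountE; apply: eq_bigr => x _; rewrite ffunE.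
have [-> | //] := eqVneq (f0 x) i; case: (g0 x == r); rewrite ?eqxx //=.
by rewrite (negPf straight_neq).
Qed.

Lemma straight_sdom : (0 < paircount f0 g0 (i, r))%N ->
  comp_sdom (content h0) (content f0).
Proof.
rewrite paircountE lt0n sum_nat_eq0 negb_forall => /existsP[x].
rewrite implyTb eqb0 negbK => /andP[/eqP fx /eqP gx].
have le y : (h0 y <= f0 y)%N.
  by case: (straight_move y) => [-> // | [-> ->]]; apply: ltnW.
apply: (@comp_sdomP _ _ _ r.+1) => [|m|]; first exact: ltn_ord.
  rewrite !psum_content; apply: leq_sum => y _.
  by case: ltnP => //= lty; rewrite (leq_ltn_trans (le y) lty).
rewrite !psum_content (bigD1 x) //= [X in (_ < X)%N](bigD1 x) //=.
rewrite ffunE fx gx !eqxx /= ltnSn [(i < r.+1)%N]ltnNge lt_ri add0n add1n ltnS.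
apply: leq_sum => y _.
by case: ltnP => //= lty; rewrite (leq_ltn_trans (le y) lty).
Qed.

Definition moved (f h g : word) c :=
  (\sum_x [&& f x == i, h x == r & g x == c])%N.

Section Middle.

Variables f h g : word.
Hypotheses (fh : paircount f h = paircount f0 h0)
           (hg : paircount h g = paircount h0 g0).

(** The only nonzero off-diagonal position of [paircount f0 h0] is (i, r), so a word paired with f
    as h0 is with f0 can only change letters i into r. *)
Lemma middle_move x : h x = f x \/ f x = i /\ h x = r.
Proof.
have [->|nfh] := eqVneq (h x) (f x); [by left | right].
have : (0 < paircount f h (f x, h x))%N.
  by rewrite paircountE (bigD1 x) //= !eqxx.
rewrite fh paircountE lt0n sum_nat_eq0 negb_forall => /existsP[y].
rewrite implyTb eqb0 negbK => /andP[/eqP fy /eqP hy].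
case: (straight_move y) => [e | []]; last by rewrite fy hy.
by rewrite -fy -hy e eqxx in nfh.
Qed.

Lemma sum_moved : (\sum_c moved f h g c = paircount f0 g0 (i, r))%N.
Proof.
rewrite -paircount_straight -fh paircountE exchange_big; apply: eq_bigr => x _ /=.
rewrite (bigD1 (g x)) //= eqxx big1 => [|c ngc].
  by rewrite addn0 andbT.
by rewrite [g x == c]eq_sym (negPf ngc) !andbF.
Qed.

Lemma moved_straight c :
  moved f0 h0 g0 c = ((c == r) * paircount f0 g0 (i, r))%N.
Proof.
rewrite paircountE big_distrr; apply: eq_bigr => x _ /=; rewrite ffunE.
have [-> | _] := eqVneq (f0 x) i; last by rewrite muln0.
rewrite /=; have [-> | ngr] := eqVneq (g0 x) r.
  by rewrite eqxx muln1 eq_sym.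
by rewrite (negPf straight_neq) muln0.
Qed.

(** Passing from f to h and from f0 to h0 leads to the same pair matrix, so those of (f, g) and (f0,
    g0) differ exactly by what each change moves. *)
Lemma paircount_middle a c :
  (paircount f g (a, c) + (a == r) * moved f h g c
      + (a == i) * ((c == r) * paircount f0 g0 (i, r))
   = paircount f0 g0 (a, c) + (a == r) * ((c == r) * paircount f0 g0 (i, r))
      + (a == i) * moved f h g c)%N.
Proof.
have := paircount_move g straight_neq middle_move a c.
rewrite -/(moved f h g c) => ->; rewrite hg.
have := paircount_move g0 straight_neq straight_move a c.
rewrite -/(moved f0 h0 g0 c) moved_straight => ->.
by rewrite addnAC.
Qed.

Lemma moved_le : (moved f h g r <= paircount f0 g0 (i, r))%N.
Proof. by rewrite -sum_moved (bigD1 r) //= leq_addr. Qed.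

Lemma moved_eq0 : moved f h g r = paircount f0 g0 (i, r) ->
  forall c, c != r -> moved f h g c = 0%N.
Proof.
move=> e c ncr; have := sum_moved; rewrite (bigD1 r) //= e -[RHS]addn0 => /eqP.
rewrite eqn_add2l sum_nat_eq0 => /forallP/(_ c); by rewrite ncr => /eqP.
Qed.

Lemma middle_diag_lt (s : 'I_n) : (s < r)%N ->
  paircount f g (s, s) = paircount f0 g0 (s, s).
Proof.
move=> ltsr; have := paircount_middle s s.
have -> : (s == r) = false by rewrite -val_eqE /= ltn_eqF.
have -> : (s == i) = false by rewrite -val_eqE /= ltn_eqF // (ltn_trans ltsr).
by rewrite !mul0n !addn0.
Qed.

(** The straightened word moves its whole amount within column r. Another middle word moves at most
    as much there, which leaves the (r, r) entry of (f, g) at least as large; equality forces all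
    columns, hence the pair matrices, to agree. *)
Lemma middle_diag_gt : paircount f g != paircount f0 g0 ->
  (paircount f0 g0 (r, r) < paircount f g (r, r))%N.
Proof.
have := paircount_middle r r; rewrite eqxx eq_sym (negPf straight_neq).
rewrite !mul0n !addn0 !mul1n => e.
have := moved_le; rewrite leq_eqVlt => /orP[/eqP emv | lt _]; last first.
  by rewrite -(ltn_add2r (moved f h g r)) e ltn_add2l.
case/negP; apply/eqP/ffunP=> [[a c]]; have := paircount_middle a c.
have -> : moved f h g c = ((c == r) * paircount f0 g0 (i, r))%N.
  by have [-> | ncr] := eqVneq c r; rewrite ?mul1n // moved_eq0 ?mul0n.
by move/addIn/addIn.
Qed.

End Middle.

(** This uniqueness makes the orbit sum of (f0, g0) occur in the product with coefficient 1. The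
    count in column r forces h to change every position with letters (i, r), and nothing is left to
    change in other columns. *)
Lemma middle_unique h : paircount f0 h = paircount f0 h0 ->
  paircount h g0 = paircount h0 g0 -> h = h0.
Proof.
move=> fh hg; have := paircount_middle fh hg r r.
rewrite eqxx eq_sym (negPf straight_neq) !mul0n !addn0 !mul1n => /addnI emv.
have h1 x : f0 x = i -> g0 x = r -> h x = r.
  move=> fx gx; apply/eqP; apply: contraT => nhr; have /eqP := emv.
  rewrite paircountE /moved (bigD1 x) //= [X in _ == X](bigD1 x) //=.
  rewrite fx gx !eqxx (negPf nhr) /= add0n add1n ltn_eqF // ltnS.
  by apply: leq_sum => y _; case: (f0 y == i); case: (h y == r); case: (g0 y == r).
apply/ffunP=> x; rewrite ffunE; case: andP => [[/eqP fx /eqP gx] | ngf].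
  exact: h1.
have [-> // | [fx hx]] := middle_move fh x.
have ngr : g0 x != r by apply/negP=> gr; case: ngf; rewrite fx eqxx.
have := moved_eq0 fh emv ngr; rewrite /moved (bigD1 x) //= fx hx !eqxx.
by [].
Qed.

End Straightening.

(** The outer induction is on the number r of leading rows where the pair matrix is already
    diagonal, the inner one on the deficit of its (r, r) entry. A fully diagonal matrix forces f = g
    and gives the projector itself; each straightened product contributes the scalar 0. *)
Lemma theta_triangular f g : content f = content g ->
  triangular (content f) (theta (paircount f g)).
Proof.
pose k := content f; rewrite -/k.
suff IH r : (r <= n)%N -> forall f g, content f = k -> content g = k ->
    (forall s : 'I_n, (s < r)%N -> paircount f g (s, s) = k s) ->
    triangular k (theta (paircount f g)).
  by move=> cg; apply: (IH 0%N).
move: k => k {f g}; have [m] := ubnP (n - r); elim: m r => // m IHm r ltm.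
rewrite leq_eqVlt => /orP[/eqP rn | ltr] f g cf cg diag.
  have -> : g = f.
    by apply/esym/paircount_diag_eq => s; rewrite cf diag // rn.
  rewrite theta_diag cf; exists 1; rewrite scale1r subrr; exact: Above0.
pose r' := Ordinal ltr.
have [d] := ubnP (k r' - paircount f g (r', r')).
elim: d => // d IHd in f g cf cg diag *; rewrite ltnS => led.
have le_kr : (paircount f g (r', r') <= k r')%N.
  by rewrite -cf -(paircount_suml f g) (bigD1 r') //= leq_addr.
have [e | ne] := eqVneq (paircount f g (r', r')) (k r').
  apply: (IHm r.+1) => // [|s].
    by rewrite -ltnS; apply: leq_trans ltm; rewrite ltnS ltn_sub2l.
  rewrite ltnS leq_eqVlt => /orP[/eqP sr | /diag //].
  by have -> : s = r' by apply: val_inj.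
(* Column r' sums to [k r'] but its diagonal entry is smaller, and the rows above r' are diagonal,
   so the missing amount lies strictly below the diagonal. *)
have [i ltri pos_i] : exists2 i : 'I_n, (r' < i)%N & (0 < paircount f g (i, r'))%N.
  have : (0 < \sum_(i | i != r') paircount f g (i, r'))%N.
    rewrite -(ltn_add2l (paircount f g (r', r'))) addn0.
    have <- : (\sum_i paircount f g (i, r'))%N = 
       (paircount f g (r', r') + \sum_(i | i != r') paircount f g (i, r'))%N.
      by rewrite (bigD1 r').
    by rewrite paircount_sumr cg ltn_neqAle ne.
  rewrite lt0n sum_nat_eq0 negb_forall => /existsP[i].
  rewrite negb_imply -lt0n => /andP[nir pos_i]; exists i => //.
  rewrite ltnNge leq_eqVlt negb_or val_eqE nir /=; apply/negP => ltir.
  have := paircount_suml f g i; rewrite cf (bigD1 i) //= diag //.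
  rewrite -[RHS]addn0 => /addnI/eqP; rewrite sum_nat_eq0 => /forallP/(_ r').
  by rewrite eq_sym nir /= eqn0Ngt pos_i.
pose h := straight f g i r'.
pose P := theta (paircount f h) *m theta (paircount h g).
have PE (f' g' : word) : P (enum_rank f') (enum_rank g') = \sum_h'
    ((paircount f' h' == paircount f h) && (paircount h' g' == paircount h g))%:R.
  rewrite /P fun_mxM fun_mxE; apply: eq_bigr => h' _.
  by rewrite -natrM mulnb.
have hP : mxhom rW rW P by apply: mxhomM (mxhom_theta _) (mxhom_theta _).
have P1 (f' g' : word) : paircount f g = paircount f' g' ->
    P (enum_rank f') (enum_rank g') = 1.
  case/paircount_orbit=> s [-> ->]; have /perm_homP -> := hP.
  rewrite PE (bigD1 h) //= !eqxx big1 ?addr0 // => h' /eqP nh'.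
  case: andP => // [[/eqP e1 /eqP e2]]; case: nh'.
  exact: middle_unique.
(* P factors through the larger content of h, and P minus the orbit sum is supported on pairs with a
   larger (r', r') entry, where the inner induction applies whatever the coefficients are. *)
rewrite -[theta _](subKr P); apply: triangularB.
  exists 0; rewrite scale0r subr0 /P theta_mul -[_ *m _]addr0.
  apply: AboveD; [|exact: mxhom_theta|exact: mxhom_theta|exact: Above0].
  by rewrite -cf; apply: straight_sdom.
apply: triangular_support => [|f' g'].
  exact: mxhomB hP (mxhom_theta _).
have subE (A B : 'M_W) x y : (A - B) x y = A x y - B x y by rewrite !mxE.
rewrite subE fun_mxE; have [e | ne' nz] := eqVneq (paircount f' g') (paircount f g).
  by rewrite P1 // subrr eqxx.
have [h' /andP[/eqP e1 /eqP e2]] : exists h',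
    (paircount f' h' == paircount f h) && (paircount h' g' == paircount h g).
  apply/existsP; apply: contraNT nz; rewrite negb_exists => /forallP nh.
  by rewrite PE big1 ?subr0 // => h' _; rewrite (negPf (nh h')).
apply: IHd.
- by apply/ffunP=> j; rewrite -(paircount_suml f' h') e1 paircount_suml cf.
- by apply/ffunP=> j; rewrite -(paircount_sumr h' g') e2 paircount_sumr cg.
- by move=> s lts; rewrite (middle_diag_lt ltri e1 e2) // diag.
- apply: leq_trans led; apply: ltn_sub2l; last exact: middle_diag_gt e1 e2 ne'.
  by rewrite ltn_neqAle ne.
Qed.

Lemma wproj_triangular k A : mxhom rW rW A -> triangular k (wproj k *m A *m wproj k).
Proof.
move=> hA; apply: triangular_support => [|f g].
  exact: mxhomM (mxhomM (mxhom_wproj _) hA) (mxhom_wproj _).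
rewrite wprojMr wprojMl; have [<- | _] := eqVneq (content f) k; last first.
  by rewrite !mul0r eqxx.
have [cg _ | _] := eqVneq (content g) (content f); last by rewrite mulr0 eqxx.
exact: theta_triangular.
Qed.

(** Exchanging the letters i and j commutes with permuting positions, so it identifies the images of
    the projectors of k and of k', and k' is strictly larger because the bigger part moves forward.
    This is how the climb passes contents that are not partitions. *)
Lemma above_swap (k : {ffun 'I_n -> nat}) (i j : 'I_n) :
  (i < j)%N -> (k i < k j)%N -> above k (wproj k).
Proof.
move=> ltij ltk.
have nij : i != j by rewrite -val_eqE /= ltn_eqF.
pose k' := [ffun x => k (tperm i j x)].
have k'E x : k' x = k (tperm i j x) by rewrite ffunE.
pose T := fun_mx (fun f g : word => (g == [ffun x => tperm i j (f x)])%:R : K).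
have hT : mxhom rW rW T.
  apply/perm_homP=> f g s; rewrite !fun_mxE; congr (_%:R); congr nat_of_bool.
  rewrite -(inj_eq (act_inj (word_action n) s) g); congr (_ == _).
  by apply/ffunP=> x; rewrite !ffunE.
have -> : wproj k = T *m wproj k' *m T + 0.
  rewrite addr0; apply: fun_mxP => f g; rewrite fun_mxE.
  pose f' : word := [ffun x => tperm i j (f x)].
  have cf' : (content f' == k') = (content f == k).
    have e x : content f' x = content f (tperm i j x).
      rewrite !contentE; apply: eq_bigr => y _; rewrite ffunE.
      by rewrite -(inj_eq (@perm_inj _ (tperm i j)) (f y)) tpermK.
    apply/eqP/eqP=> /ffunP ck; apply/ffunP=> x.
      by have := ck (tperm i j x); rewrite e k'E !tpermK.
    by rewrite e ck k'E.
  rewrite mxE sum_rank (bigD1 f') //= big1 => [|h nh].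
    rewrite wprojMr !fun_mxE eqxx mul1r addr0 cf' -natrM mulnb andbC.
    congr (_%:R); congr nat_of_bool; congr (_ && _); rewrite eq_sym; congr (_ == _).
    by apply/ffunP=> x; rewrite !ffunE tpermK.
  by rewrite wprojMr fun_mxE (negPf nh) !mul0r.
apply: AboveD => //; last exact: Above0.
have psumE (l : {ffun 'I_n -> nat}) m : psum l m
   = ((i < m) * l i + ((j < m) * l j + \sum_(x | (x != i) && (x != j)) (x < m) * l x))%N.
  by rewrite /psum (bigD1 i) //= (bigD1 j) //= eq_sym.
have rest m : (\sum_(x | (x != i) && (x != j)) (x < m) * k' x
    = \sum_(x | (x != i) && (x != j)) (x < m) * k x)%N.
  apply: eq_bigr => x /andP[xi xj].
  by rewrite ffunE tpermD // eq_sym.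
have [ki kj] : k' i = k j /\ k' j = k i by rewrite !ffunE tpermL tpermR.
apply: (@comp_sdomP _ _ _ i.+1) => [|m|]; first exact: ltn_ord.
  rewrite !psumE rest ki kj !addnA leq_add2r.
  case: (ltnP j m) => [ltjm | _].
    by rewrite (ltn_trans ltij ltjm) !mul1n addnC.
  by rewrite !mul0n !addn0 leq_mul2l (ltnW ltk) orbT.
rewrite !psumE rest ki kj !addnA ltn_add2r ltnSn [(j < i.+1)%N]ltnNge ltij.
by rewrite !mul0n !addn0 !mul1n.
Qed.

End SchurAlgebra.

(** * Tabloids and polytabloids *)

Section TabloidWords.

Variables (n : nat) (lam : intpart n).
Implicit Types (t : tableau lam) (x : 'I_n).

Lemma tableau_surj t x : exists c, t c == x.
Proof.
have inj_t : injective t by apply/injectiveP; apply: entryP.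
have [g _ gK] : bijective t.
  by apply: inj_card_bij => //; rewrite card_cell card_ord.
by exists (g x); rewrite gK.
Qed.

Definition cell_at t x : cell lam := xchoose (tableau_surj t x).

Lemma cell_atK t x : t (cell_at t x) = x.
Proof. exact/eqP/(xchooseP (tableau_surj t x)). Qed.

Lemma entryK t c : cell_at t (t c) = c.
Proof. by apply: (injectiveP _ (entryP t)); rewrite cell_atK. Qed.

Definition tableau_word t : word n := [ffun x => tag (cell_at t x)].

Definition col_at t x := col_of (cell_at t x).

Lemma cell_inj (c d : cell lam) : tag c = tag d -> col_of c = col_of d -> c = d.
Proof.
case: c d => [i c] [j d] /= ij; case: _ / ij d => d.
by rewrite /col_of /= => cd; congr (Tagged _ _); apply: val_inj.
Qed.

Lemma mem_row_set t (i : 'I_n) x : (x \in row_set t i) = (tableau_word t x == i).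
Proof.
apply/imsetP/idP => [[c] | e].
  by rewrite inE => /eqP ci ->; rewrite ffunE entryK; apply/eqP/val_inj.
exists (cell_at t x); last by rewrite cell_atK.
by rewrite inE /row_of; move: e; rewrite ffunE => /eqP ->.
Qed.

Lemma mem_col_set t (j : nat) x : (x \in col_set t j) = (col_at t x == j).
Proof.
apply/imsetP/idP => [[c] | e].
  by rewrite inE => ci ->; rewrite /col_at entryK.
by exists (cell_at t x); rewrite ?cell_atK.
Qed.

Lemma row_equivP t u : reflect (tableau_word t = tableau_word u) (row_equiv t u).
Proof.
apply: (iffP forallP) => [e | e i]; last first.
  by apply/eqP/setP=> x; rewrite !mem_row_set e.
apply/ffunP=> x; apply/esym/eqP; rewrite -mem_row_set -(eqP (e _)) mem_row_set.
exact: eqxx.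
Qed.

Lemma tableau_word_act t s :
  tableau_word (tab_act t s) = word_act (tableau_word t) s.
Proof.
apply/ffunP=> x; rewrite !ffunE; congr tag.
apply: (injectiveP _ (entryP (tab_act t s))); rewrite cell_atK ffunE cell_atK.
by rewrite permKV.
Qed.

Lemma tabloid_ofP t u : tabloid_of t = tabloid_of u <-> tableau_word t = tableau_word u.
Proof.
split=> [/(congr1 val) /setP/(_ u) | e].
  rewrite !inE /= => tu; apply/row_equivP; rewrite tu; exact/row_equivP.
apply/val_inj/setP=> v; rewrite !inE /=.
by apply/row_equivP/row_equivP; rewrite e.
Qed.

Lemma tabloid_rep (T : tabloid lam) : exists t, T == tabloid_of t.
Proof.
by have /imsetP[t _ e] := tabloidP T; exists t; apply/eqP/val_inj.
Qed.

Definition tabloid_word (T : tabloid lam) : word n :=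
  tableau_word (xchoose (tabloid_rep T)).

Lemma tabloid_word_of t : tabloid_word (tabloid_of t) = tableau_word t.
Proof.
by apply/esym/tabloid_ofP; apply/eqP/(xchooseP (tabloid_rep (tabloid_of t))).
Qed.

Lemma tabloid_act_of t s : tabloid_act (tabloid_of t) s = tabloid_of (tab_act t s).
Proof.
apply/val_inj/setP=> u /=; apply/imsetP/idP => [[v] | ].
  by rewrite !inE /= => tv ->; rewrite row_equiv_act.
rewrite !inE /= => tu; exists (tab_act u s^-1).
  by rewrite !inE /= -(row_equiv_act s) -tab_actM mulVg tab_act1.
by rewrite -tab_actM mulVg tab_act1.
Qed.

Lemma tabloid_word_inj : injective tabloid_word.
Proof.
move=> T U; have [t /eqP->] := tabloid_rep T; have [u /eqP->] := tabloid_rep U.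
by rewrite !tabloid_word_of => /tabloid_ofP.
Qed.

Lemma tabloid_word_act T s :
  tabloid_word (tabloid_act T s) = word_act (tabloid_word T) s.
Proof.
have [t /eqP->] := tabloid_rep T.
by rewrite tabloid_act_of !tabloid_word_of tableau_word_act.
Qed.

Definition part_content : {ffun 'I_n -> nat} := [ffun i => lam i : nat].

Lemma content_tableau_word t : content (tableau_word t) = part_content.
Proof.
apply/ffunP=> i; rewrite contentE ffunE.
have -> : (\sum_x (tableau_word t x == i) = \sum_(c : cell lam) (tag c == i))%N.
  rewrite (reindex t) /=; last first.
    by exists (cell_at t) => x _; rewrite ?entryK ?cell_atK.
  by apply: eq_bigr => c _; rewrite ffunE entryK.
rewrite -(sig_big_dep xpredT (fun _ => xpredT) (fun j _ => (j == i) : nat)) /=.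
rewrite (bigD1 i) //= [X in (_ + X)%N]big1 => [|j /negPf nji]; last first.
  by apply: big1 => c _; rewrite nji.
by rewrite addn0 eqxx sum1_card card_ord.
Qed.

Lemma shape_anti (i j : 'I_n) : (i <= j)%N -> (lam j <= lam i)%N.
Proof. by have /andP[/forallP/(_ i)/forallP/(_ j)/implyP h _] := intpartP lam. Qed.

Lemma col_at_lt t x : (col_at t x < n)%N.
Proof.
by apply: leq_trans (ltn_ord (tagged (cell_at t x))) _; rewrite -ltnS.
Qed.

Lemma col_lt_shape t x : (col_at t x < lam (tableau_word t x))%N.
Proof. by rewrite ffunE; apply: ltn_ord. Qed.

Lemma col_stabP t (s : 'S_n) :
  reflect (forall x, col_at t (s x) = col_at t x) (s \in col_stab t).
Proof.
rewrite inE; apply: (iffP forallP) => [st x | st j].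
  have /eqP/setP/(_ (s x)) := st (Ordinal (col_at_lt t x)).
  by rewrite mem_imset ?mem_col_set ?eqxx; [move/esym/eqP | apply: perm_inj].
apply/eqP/setP=> x; rewrite -(permKV s x) mem_imset; last exact: perm_inj.
by rewrite !mem_col_set st.
Qed.

(** Column by column: distinct letters below m number at most the smaller of m and the column
    length, a bound attained by the row word of [t]. Summing over columns compares the partial
    sums. *)
Lemma col_injective_dom t (f : word n) :
    (forall x y, col_at t x = col_at t y -> f x = f y -> x = y) ->
  comp_dom part_content (content f).
Proof.
move=> inj_f m; rewrite -(content_tableau_word t) !psum_content.
have byc (h : word n) : (\sum_x (h x < m) =
    \sum_(j < n) #|[set x | (col_at t x == j) && (h x < m)]|)%N.
  under [RHS]eq_bigr => j _ do rewrite -sum1dep_card big_mkcond /=.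
  rewrite exchange_big; apply: eq_bigr => x _ /=.
  rewrite (bigD1 (Ordinal (col_at_lt t x))) //= eqxx big1 => [|j nj].
    by rewrite addn0; case: ltnP.
  case: eqP => //= e; case/eqP: nj; exact/val_inj.
rewrite !byc; apply: leq_sum => j _; set w := tableau_word t.
have [/forallP full | ] := boolP [forall i : 'I_n, (i < m)%N ==> (j < lam i)%N].
  apply: (@leq_trans #|[set i : 'I_n | (i < m)%N]|).
    rewrite -(card_in_imset (f := f)) => [|x y]; last first.
      rewrite !inE => /andP[/eqP cx _] /andP[/eqP cy _]; apply: inj_f.
      by rewrite cx cy.
    by apply/subset_leq_card/subsetP=> i /imsetP[x]; rewrite !inE => /andP[_ lt] ->.
  apply: leq_trans (leq_imset_card w _); apply/subset_leq_card/subsetP=> i.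
  rewrite inE => ltim; have ltj := implyP (full i) ltim.
  apply/imsetP; exists (t (Tagged (fun i => 'I_(lam i)) (Ordinal ltj))).
    by rewrite inE /w ffunE /col_at entryK /= eqxx.
  by rewrite /w ffunE entryK.
(* Some row i < m misses column j, so the column lies entirely above row i and each of its entries
   is counted for the row word. *)
rewrite negb_forall => /existsP[i]; rewrite negb_imply -leqNgt => /andP[ltim lej].
apply/subset_leq_card/subsetP=> x; rewrite !inE => /andP[/eqP cx _].
rewrite cx eqxx /=; apply: leq_ltn_trans ltim; rewrite leqNgt; apply/negP=> lti.
have := col_lt_shape t x; rewrite cx ltnNge (leq_trans _ lej) //.
by apply: shape_anti; apply: ltnW.
Qed.

End TabloidWords.

Section Polytabloid.

Variables (K : fieldType) (n : nat) (lam : intpart n).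
Local Notation word := (word n).
Local Notation rW := (perm_rep K (word_action n)).
Local Notation rM := (tabloid_module K lam).

Definition tabloid_to_word : 'M[K]_(#|{: tabloid lam}|, #|word|) :=
  fun_mx (fun (T : tabloid lam) (f : word) => (tabloid_word T == f)%:R).

Definition word_to_tabloid : 'M[K]_(#|word|, #|{: tabloid lam}|) :=
  fun_mx (fun (f : word) (T : tabloid lam) => (tabloid_word T == f)%:R).

Lemma mxhom_tabloid_to_word : mxhom rM rW tabloid_to_word.
Proof.
apply/perm_homP=> T f s; rewrite !fun_mxE /= tabloid_word_act.
by rewrite (inj_eq (act_inj (word_action n) s)).
Qed.

Lemma mxhom_word_to_tabloid : mxhom rW rM word_to_tabloid.
Proof.
apply/perm_homP=> f T s; rewrite !fun_mxE /= tabloid_word_act.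
by rewrite (inj_eq (act_inj (word_action n) s)).
Qed.

Lemma tabloid_to_wordK : tabloid_to_word *m word_to_tabloid = 1%:M.
Proof.
apply: fun_mxP => T U; rewrite fun_mxM fun_mxE mxE (inj_eq enum_rank_inj).
rewrite (bigD1 (tabloid_word T)) //= eqxx mul1r big1 => [|f nf].
  by rewrite addr0 (inj_eq (@tabloid_word_inj _ _)) eq_sym.
by rewrite eq_sym (negPf nf) mul0r.
Qed.

Lemma tabloid_to_word_proj :
  tabloid_to_word *m wproj K (part_content lam) = tabloid_to_word.
Proof.
apply: fun_mxP => T f; rewrite mxE sum_rank (bigD1 f) //= big1 => [|g ng].
  rewrite !fun_mxE eqxx addr0 -natrM mulnb; congr (_%:R); congr nat_of_bool.
  case: eqP => //= <-; have [t /eqP->] := tabloid_rep T.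
  by rewrite tabloid_word_of content_tableau_word eqxx.
by rewrite [X in _ * X]fun_mxE (negPf ng) mulr0.
Qed.

Variable t : tableau lam.
Local Notation S := (\sum_(s in col_stab t) (-1) ^+ s *: rW s).

Lemma polytabloid_word : polytabloid K t *m tabloid_to_word
  = perm_vec K (tableau_word t) *m S.
Proof.
rewrite /polytabloid -mulmxA mulmx_suml.
have -> : \sum_(s in col_stab t) (-1) ^+ s *: rM s *m tabloid_to_word
    = tabloid_to_word *m S.
  rewrite mulmx_sumr; apply: eq_bigr => s _.
  by rewrite -scalemxAl -scalemxAr mxhom_tabloid_to_word ?inE.
rewrite mulmxA; congr (_ *m _); apply/rowP=> j; rewrite -(enum_valK j).
rewrite -rowE !mxE !enum_rankK eqxx /= tabloid_word_of.
by rewrite (inj_eq enum_rank_inj) eq_sym.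
Qed.

Lemma perm_vec_antisym f : perm_vec K f *m S
  = \sum_(s in col_stab t) (-1) ^+ s *: perm_vec K (word_act f s).
Proof.
rewrite mulmx_sumr; apply: eq_bigr => s _.
by rewrite -scalemxAr [_ *m _](perm_vec_act K (word_action n) f s).
Qed.

(** The terms of s and [tau * s] have equal words and opposite signs. They are cancelled in pairs,
    since a vector equal to its negative need not vanish in characteristic 2. *)
Lemma perm_vec_antisym0 (f : word) x y :
  x != y -> col_at t x = col_at t y -> f x = f y -> perm_vec K f *m S = 0.
Proof.
move=> nxy cxy fxy; rewrite perm_vec_antisym.
pose tau := tperm x y.
have ctau z : col_at t (tau z) = col_at t z.
  by rewrite /tau; case: tpermP => [->|->|].
have stab_tau s : (tau * s \in col_stab t)%g = (s \in col_stab t).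
  apply/col_stabP/col_stabP => st z; last by rewrite permM st ctau.
  by have := st (tau z); rewrite permM tpermK ctau.
rewrite (bigID (fun s : 'S_n => odd_perm s)) /=.
rewrite (reindex_inj (mulgI tau)) /= -[RHS](addNr
  (\sum_(s in col_stab t | ~~ odd_perm s) (-1) ^+ s *: perm_vec K (word_act f s))).
congr (_ + _); rewrite -sumrN; apply: eq_big => s.
  by rewrite stab_tau odd_mul_tperm nxy.
rewrite odd_mul_tperm nxy /= => /andP[_ ns]; rewrite ns (negPf ns) expr1 expr0.
rewrite scaleN1r scale1r word_actM; congr (- perm_vec K (word_act _ s)).
by apply/ffunP=> z; rewrite ffunE tpermV /tau; case: tpermP => [->|->|].
Qed.

Lemma row_word_sum (u : 'rV[K]_#|word|) :
  u = \sum_(f : word) u 0 (enum_rank f) *: perm_vec K f.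
Proof. by rewrite [LHS]row_sum_delta sum_rank. Qed.

(** The column antisymmetriser S commutes with [A] and the projector, so the vector is a combination
    of antisymmetrised words of content k. A nonzero term has distinct letters in each column, which
    forces dominance. *)
Lemma polytabloid_kill A k : mxhom rW rW A ->
  polytabloid K t *m tabloid_to_word *m A *m wproj K k != 0 ->
  comp_dom (part_content lam) k.
Proof.
move=> hA nz; apply: boolp.contrapT => ndom; case/negP: nz; apply/eqP.
rewrite polytabloid_word -(mulmxA _ S).
have SA B : mxhom rW rW B -> S *m B = B *m S.
  move=> hB; rewrite mulmx_suml mulmx_sumr; apply: eq_bigr => s _.
  by rewrite -scalemxAl -scalemxAr hB ?inE.
rewrite SA // -mulmxA -(mulmxA A) SA; last exact: mxhom_wproj.
rewrite !mulmxA; set u := _ *m wproj K k.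
rewrite [u]row_word_sum mulmx_suml big1 // => f _.
have [cf | ncf] := eqVneq (content f) k; last first.
  suff -> : u 0 (enum_rank f) = 0 by rewrite scale0r mul0mx.
  rewrite mxE sum_rank big1 // => g _; rewrite fun_mxE.
  by have [->|] := eqVneq g f; rewrite ?(negPf ncf) mulr0.
rewrite -scalemxAl; suff -> : perm_vec K f *m S = 0 by rewrite scaler0.
have [/forallP inj_f | ] := boolP [forall x, forall y,
    (col_at t x == col_at t y) && (f x == f y) ==> (x == y)].
  case: ndom; rewrite -cf; apply: (@col_injective_dom _ _ t) => x y cxy fxy.
  by have /forallP/(_ y) := inj_f x; rewrite cxy fxy !eqxx => /eqP.
rewrite negb_forall => /existsP[x]; rewrite negb_forall => /existsP[y].
rewrite negb_imply => /andP[/andP[/eqP cxy /eqP fxy] nxy].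
exact: perm_vec_antisym0 nxy cxy fxy.
Qed.

(** The row word of [t] has coefficient 1: a column permutation that preserves rows fixes every
    cell, so only the identity contributes. *)
Lemma polytabloid_word_neq0 : polytabloid K t *m tabloid_to_word != 0.
Proof.
rewrite polytabloid_word perm_vec_antisym; set w := tableau_word t.
apply/eqP=> /rowP/(_ (enum_rank w)); rewrite summxE mxE.
rewrite (bigD1 1%g) /=; last by apply/col_stabP=> x; rewrite perm1.
rewrite odd_perm1 expr0 scale1r word_act1 mxE !eqxx big1 => [|s /andP[st ns]].
  by move/eqP; rewrite addr0 oner_eq0.
rewrite 2!mxE eqxx /= (inj_eq enum_rank_inj); case: eqP => [e | _]; last first.
  by rewrite mulr0.
case/eqP: ns; apply/permP=> x; rewrite perm1.
rewrite -[LHS](cell_atK t) -[RHS](cell_atK t); congr (t _); apply: cell_inj.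
  by have /ffunP/(_ (s x)) := e; rewrite /w !ffunE permK => <-.
exact: (col_stabP _ _ st).
Qed.

End Polytabloid.

(** * Young modules *)

Section YoungModuleTheory.

Variables (K : fieldType) (n : nat).
Local Notation rW := (perm_rep K (word_action n)).
Local Notation reprS := (mx_representation K [set: 'S_n]%G).
Local Notation rM := (tabloid_module K).
Implicit Types lam mu : intpart n.

(** X is a direct summand of the permutation module of content k, where k need not be weakly
    decreasing. *)
Definition occurs m (X : reprS m) (k : {ffun 'I_n -> nat}) := exists a b,
  [/\ mxhom X rW a, mxhom rW X b & a *m wproj K k *m b = 1%:M].

Definition specht_gen (lam : intpart n) :=
  polytabloid K (canonical_tableau lam) *m tabloid_to_word K lam.

(** A form of [is_young_module] by maps to and from the word module: containing the Specht module
    becomes the condition that the projection fixes its generator. *)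
Definition young_split (lam : intpart n) m (Y : reprS m) :=
  mx_indecomposable Y /\ exists A B, [/\ mxhom Y rW A, mxhom rW Y B,
    A *m B = 1%:M, A *m wproj K (part_content lam) = A
    & specht_gen lam *m B *m A = specht_gen lam].

Lemma mxhom_above k C : above k C -> mxhom rW rW C.
Proof.
elim=> [|l A B D _ hA hB _ hD]; first exact: mxhom0.
exact: mxhomD (mxhomM (mxhomM hA (mxhom_wproj _ _)) hB) hD.
Qed.

(** By locality, an invertible sum of endomorphisms of X through larger contents has an invertible
    term, which exhibits X as a summand at that content. *)
Lemma above_occurs m (X : reprS m) k C a b : local_repr X -> above k C ->
    mxhom X rW a -> mxhom rW X b -> a *m C *m b \in unitmx ->
  exists2 l, comp_sdom l k & occurs X l.
Proof.
move=> locX abC ha hb; elim: abC => [|l A B D lk hA hB abD IHD].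
  by rewrite mulmx0 mul0mx => /(local_unit0 locX).
have he := @mxhom_wproj K n l; rewrite mulmxDr mulmxDl.
have h1 := mxhomM (mxhomM ha (mxhomM (mxhomM hA he) hB)) hb.
have h2 := mxhomM (mxhomM ha (mxhom_above abD)) hb.
case/(local_unitD locX h1 h2)/orP => // u; exists l => //.
set c := a *m (A *m wproj K l *m B) *m b in h1 u.
exists (a *m A), (B *m b *m invmx c); split.
- exact: mxhomM ha hA.
- exact: mxhomM (mxhomM hB hb) (mxhomV h1 u).
by rewrite -[RHS](mulmxV u) {2}/c !mulmxA.
Qed.

Lemma summand_occurs m (X : reprS m) m' (X' : reprS m') k :
  is_summand X' X -> occurs X k -> occurs X' k.
Proof.
move=> [C [D [hC hD CD]]] [a [b [ha hb ab]]]; exists (C *m a), (b *m D).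
split; [exact: mxhomM hC ha | exact: mxhomM hb hD |].
by rewrite -CD -[C in RHS]mulmx1 -ab !mulmxA.
Qed.

Lemma tabloid_occurs lam : occurs (rM lam) (part_content lam).
Proof.
exists (tabloid_to_word K lam), (word_to_tabloid K lam); split.
- exact: mxhom_tabloid_to_word.
- exact: mxhom_word_to_tabloid.
by rewrite tabloid_to_word_proj tabloid_to_wordK.
Qed.

Lemma specht_gen_neq0 lam : specht_gen lam != 0.
Proof. exact: polytabloid_word_neq0. Qed.

Lemma specht_gen_proj lam : specht_gen lam *m wproj K (part_content lam) = specht_gen lam.
Proof. by rewrite -mulmxA tabloid_to_word_proj. Qed.

Lemma specht_gen_dom lam A k : mxhom rW rW A ->
  specht_gen lam *m A *m wproj K k != 0 -> comp_dom (part_content lam) k.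
Proof. exact: polytabloid_kill. Qed.

Lemma specht_gen_above lam C : above (part_content lam) C -> specht_gen lam *m C = 0.
Proof.
elim=> [|l A B D lk hA hB _ IHD]; first by rewrite mulmx0.
rewrite mulmxDr IHD addr0 !mulmxA.
have [-> | /(specht_gen_dom hA)] := eqVneq (specht_gen lam *m A *m wproj K l) 0.
  by rewrite mul0mx.
by move/(comp_sdomN lk).
Qed.

(** Both clauses share the scalar c: this ties killing the polytabloid to factoring through strictly
    larger contents. *)
Lemma specht_gen_eigen lam A : mxhom rW rW A -> let e := wproj K (part_content lam) in
  exists c, above (part_content lam) (e *m A *m e - c *: e)
    /\ specht_gen lam *m A *m e = c *: specht_gen lam.
Proof.
move=> hA e; have [c ab] := wproj_triangular (part_content lam) hA; exists c; split=> //.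
have := specht_gen_above ab; rewrite mulmxBr -scalemxAr specht_gen_proj !mulmxA.
by rewrite specht_gen_proj => /eqP; rewrite subr_eq0 => /eqP.
Qed.

Lemma tabloid_eigenvector lam :
  End_eigenvector (rM lam) (polytabloid K (canonical_tableau lam)).
Proof.
split.
  by apply: contraNneq (specht_gen_neq0 lam); rewrite /specht_gen => ->; rewrite mul0mx.
move=> A hA; pose i := tabloid_to_word K lam; pose j := word_to_tabloid K lam.
have hi : mxhom (rM lam) rW i by exact: mxhom_tabloid_to_word.
have hj : mxhom rW (rM lam) j by exact: mxhom_word_to_tabloid.
have ij : i *m j = 1%:M by exact: tabloid_to_wordK.
have [c [_ e]] := specht_gen_eigen lam (mxhomM (mxhomM hj hA) hi); exists c.
have ie : i *m wproj K (part_content lam) = i by exact: tabloid_to_word_proj.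
move/(congr1 (fun u => u *m j)): e.
rewrite -!mulmxA (mulmxA i (wproj _ _)) ie ij mulmx1 -scalemxAl.
by rewrite /specht_gen -!mulmxA -/i ij mulmx1 (mulmxA i) ij mul1mx.
Qed.

Section YoungSplit.

Variables (lam : intpart n) (m : nat) (Y : reprS m).
Hypothesis youngY : young_split lam Y.

Lemma young_split_eigenvector : exists u, End_eigenvector Y u.
Proof.
have [indY [A [B [hA hB AB Ae vBA]]]] := youngY.
exists (specht_gen lam *m B); split.
  apply: contraNneq (specht_gen_neq0 lam) => uB0.
  by rewrite -vBA uB0 mul0mx.
move=> C hC; have [c [_ e]] := specht_gen_eigen lam (mxhomM (mxhomM hB hC) hA).
exists c; move/(congr1 (fun u => u *m B)): e; move: (specht_gen lam) => v.
by rewrite -!mulmxA (mulmxA A (wproj _ _)) Ae AB mulmx1 -scalemxAl.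
Qed.

Lemma young_split_occurs : occurs Y (part_content lam).
Proof.
by have [indY [A [B [hA hB AB Ae vBA]]]] := youngY; exists A, B; rewrite Ae.
Qed.

Lemma young_split_dom k : occurs Y k -> comp_dom (part_content lam) k.
Proof.
have [indY [A [B [hA hB AB Ae vBA]]]] := youngY; move=> [a [b [ha hb ab]]].
apply: (specht_gen_dom (mxhomM hB ha)); rewrite mulmxA.
apply: contraNneq (specht_gen_neq0 lam) => e0.
by rewrite -vBA -[specht_gen lam *m B]mulmx1 -ab !mulmxA e0 !mul0mx.
Qed.

(** The composite Y -> X -> Y multiplies the image of the polytabloid in Y by c, which is nonzero.
    One minus its multiple by c^-1 kills that vector and is not invertible, so the composite is, and
    Y is a summand of X. *)
Lemma young_split_rsim m' (X : reprS m') a b :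
    mx_indecomposable X -> mxhom X rW a -> mxhom rW X b ->
    specht_gen lam *m b *m a *m wproj K (part_content lam) != 0 ->
  mx_rsim Y X.
Proof.
move=> indX ha hb nz; have [indY [A [B [hA hB AB Ae vBA]]]] := youngY.
have locY := indecomposable_local indY.
apply: summand_local_rsim => //.
have [c [_ e]] := specht_gen_eigen lam (mxhomM hb ha).
rewrite mulmxA in e; rewrite e in nz.
have c0 : c != 0 by apply: contraNneq nz => ->; rewrite scale0r.
have hAb := mxhomM hA hb.
have haB := mxhomM (mxhomM ha (mxhom_wproj K (part_content lam))) hB.
apply: (summand_unit hAb haB); set C := _ *m _.
have hC : mxhom Y Y (c^-1 *: C) by apply/mxhomZ/(mxhomM hAb haB).
have [_ /(_ _ hC)] := locY; case/orP=> [|uC].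
  by rewrite unitmxZ // unitfE invr_eq0.
case/negP: (specht_gen_neq0 lam); rewrite -vBA -(mulmxK uC (_ *m B)).
rewrite mulmxBr mulmx1 -scalemxAr /C !mulmxA vBA e -scalemxAl scalerA.
by rewrite mulVf // scale1r subrr !mul0mx.
Qed.

End YoungSplit.

Lemma occurs_cases lam m (X : reprS m) : mx_indecomposable X ->
    occurs X (part_content lam) ->
  (forall m' (Y : reprS m'), young_split lam Y -> mx_rsim Y X)
  \/ exists2 l, comp_sdom l (part_content lam) & occurs X l.
Proof.
move=> indX [a [b [ha hb ab]]]; have locX := indecomposable_local indX.
have [c [abc e]] := specht_gen_eigen lam (mxhomM hb ha).
have [c0 | nc0] := eqVneq c 0; [right | left].
  rewrite c0 scale0r subr0 in abc.
  (* With e the projector and a e b = 1, the map a (e b a e) b is still the identity, while its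
     middle factor lies in the ideal. *)
  apply: (above_occurs locX abc ha hb).
  by rewrite !mulmxA ab mul1mx ab unitmx1.
move=> m' Y youngY; apply: (young_split_rsim youngY indX ha hb).
by rewrite -(mulmxA _ b) e scaler_eq0 negb_or nc0 specht_gen_neq0.
Qed.

Lemma is_young_split lam (Y : representation K [set: 'S_n]%G) :
  is_young_module lam Y -> young_split lam Y.
Proof.
move=> [U [modU [sumU indU spechtU simY]]].
have indY : mx_indecomposable Y := rsim_indecomposable (mx_rsim_sym simY) indU.
split=> //; have [A [B [hA hB AB vBA]]] := submod_split modU sumU.
have vU : (polytabloid K (canonical_tableau lam) <= U)%MS.
  by apply: submx_trans spechtU; apply: cyclic_mx_id.
have /rsimP[C [D [hC hD CD DC]]] := simY.
have hi := @mxhom_tabloid_to_word K n lam; have hj := @mxhom_word_to_tabloid K n lam.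
have ij := tabloid_to_wordK K lam.
exists (C *m A *m tabloid_to_word K lam), (word_to_tabloid K lam *m B *m D).
split.
- exact: mxhomM (mxhomM hC hA) hi.
- exact: mxhomM (mxhomM hj hB) hD.
- rewrite -!mulmxA (mulmxA _ (word_to_tabloid K lam)) ij mul1mx.
  by rewrite (mulmxA A) AB mul1mx.
- by rewrite -mulmxA tabloid_to_word_proj.
rewrite /specht_gen -!mulmxA (mulmxA _ (word_to_tabloid K lam)) ij mul1mx.
by rewrite (mulmxA D) DC mul1mx !mulmxA vBA.
Qed.

(** The Young module is the image of an idempotent of least rank fixing the polytabloid. An
    idempotent Q of this image acts on the polytabloid by 0 or 1, so 1 - Q or Q fixes it, and
    minimality makes that idempotent the identity. *)
Lemma young_module_exists lam : exists Y, @is_young_module K n lam Y.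
Proof.
set v := polytabloid K (canonical_tableau lam).
have [v0 eigv] := tabloid_eigenvector lam.
pose good E := [/\ mxhom (rM lam) (rM lam) E, E *m E = E & v *m E = v].
have [E [hE EE vE] minE] : exists2 E, good E &
    forall E', good E' -> (\rank E <= \rank E')%N.
  have ex : exists r, boolp.asbool (exists2 E, good E & \rank E = r).
    exists (\rank (1%:M : 'M[K]_#|{: tabloid lam}|)); apply/boolp.asboolP.
    exists 1%:M => //; split; rewrite ?mulmx1 //; exact: mxhom1.
  case: (ex_minnP ex) => r /boolp.asboolP[E gE <-] minE; exists E => // E' gE'.
  by apply: minE; apply/boolp.asboolP; exists E'.
have modE := mxhom_module hE.
have sumE : mx_summand (rM lam) E.
  by exists (1%:M - E); have [] := idem_summand hE EE.
have vE' : (v <= E)%MS by rewrite -vE submxMl.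
exists (Representation (submod_repr modE)), E, modE; split=> //; last 1 first.
- exact: mx_rsim_refl.
- have [A [B [hA hB AB BA]]] := submod_split modE sumE.
  apply: idem_indecomposable => [|Q hQ QQ].
    rewrite lt0n mxrank_eq0; apply: contraNneq v0 => E0.
    by rewrite -/v -vE E0 mulmx0.
  (* Extended to the whole module, [Q'] competes with E, so minimality gives it full rank; an
     invertible idempotent is the identity. *)
  have lift Q' : mxhom (submod_repr modE) (submod_repr modE) Q' ->
      Q' *m Q' = Q' -> v *m (B *m Q' *m A) = v -> Q' = 1%:M.
    move=> hQ' QQ' vQ'; have gQ' : good (B *m Q' *m A).
      split=> //; first exact: mxhomM (mxhomM hB hQ') hA.
      by rewrite !mulmxA -(mulmxA _ A) AB mulmx1 -(mulmxA B) QQ'.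
    have rQ' := leq_trans (minE _ gQ') (leq_trans (mxrankM_maxl _ _) (mxrankM_maxr _ _)).
    have uQ' : Q' \in unitmx by rewrite -row_free_unit /row_free eqn_leq rank_leq_row.
    by rewrite -[Q'](mulKmx uQ') QQ' mulVmx.
  have hF := mxhomM (mxhomM hB hQ) hA; have [c vF] := eigv _ hF.
  have cc : c * c = c.
    have FF : B *m Q *m A *m (B *m Q *m A) = B *m Q *m A.
      by rewrite !mulmxA -(mulmxA _ A) AB mulmx1 -(mulmxA B) QQ.
    have := vF; rewrite -{1}FF mulmxA vF -scalemxAl vF scalerA => /eqP.
    by rewrite -subr_eq0 -scalerBl scaler_eq0 (negPf v0) orbF subr_eq0 => /eqP.
  have /eqP : c * (c - 1) = 0 by rewrite mulrBr mulr1 cc subrr.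
  rewrite mulf_eq0 subr_eq0 => /orP[/eqP c0 | /eqP c1]; [left | right].
    have e : 1%:M - Q = 1%:M.
      apply: lift.
      - exact: mxhomB (@mxhom1 _ _ _ _ _) hQ.
      - by rewrite mulmxBl mul1mx mulmxBr mulmx1 QQ subrr subr0.
      - by rewrite mulmxBr mulmx1 mulmxBl mulmxBr vF c0 scale0r subr0 mulmxA BA.
    by apply: oppr_inj; apply: (addrI 1%:M); rewrite e oppr0 addr0.
  by apply: lift => //; rewrite vF c1 scale1r.
- exact: cyclic_mx_sub modE vE'.
Qed.

Lemma young_module_def lam : is_young_module lam (young_module K lam).
Proof.
rewrite /young_module; case: boolp.pselect => [ex | nex]; first exact: svalP.
by case: nex; apply: young_module_exists.
Qed.

Lemma young_moduleP lam : young_split lam (young_module K lam).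
Proof. exact/is_young_split/young_module_def. Qed.

Lemma psum_shape (lam : intpart n) m :
  psum (part_content lam) m = (\sum_(i < n | (i < m)%N) lam i)%N.
Proof.
rewrite /psum [RHS]big_mkcond; apply: eq_bigr => i _; rewrite ffunE.
by case: ltnP => _; rewrite ?mul1n.
Qed.

Lemma dominatesP (lam mu : intpart n) :
  comp_dom (part_content lam) (part_content mu) <-> dominates lam mu.
Proof.
split=> [d | /forallP d m]; first by apply/forallP=> m; rewrite -!psum_shape.
(* [dominates] tests only the cuts up to n, while [comp_dom] ranges over all naturals; partial sums
   are constant from n on. *)
have e (l : {ffun 'I_n -> nat}) : psum l m = psum l (minn m n).
  by apply: eq_bigr => i _; rewrite leq_min ltn_ord andbT.
have ltm : (minn m n < n.+1)%N by rewrite ltnS geq_minr.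
by rewrite e (e (part_content lam)) !psum_shape; apply: (d (Ordinal ltm)).
Qed.

Lemma dominates_anti (lam mu : intpart n) :
  dominates lam mu -> dominates mu lam -> lam = mu.
Proof.
move=> /dominatesP d1 /dominatesP d2.
have e m : psum (part_content lam) m = psum (part_content mu) m.
  by apply/eqP; rewrite eqn_leq d1 d2.
have psumS (l : {ffun 'I_n -> nat}) (i : 'I_n) : psum l i.+1 = (psum l i + l i)%N.
  rewrite /psum (bigD1 i) //= [in RHS](bigD1 i) //= ltnSn ltnn mul1n mul0n add0n addnC.
  by congr (_ + _)%N; apply: eq_bigr => j nj; rewrite ltnS leq_eqVlt val_eqE (negPf nj).
apply/val_inj/ffunP=> i; apply: val_inj => /=.
have := psumS (part_content lam) i; rewrite !e psumS => /addnI; by rewrite !ffunE.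
Qed.

Lemma occurs_content m (X : reprS m) k : (0 < m)%N -> occurs X k ->
  exists f : word n, content f = k.
Proof.
case: m X => // m X _ [a [b [_ _ ab]]]; apply: boolp.contrapT => nex.
have e0 : wproj K k = 0.
  apply: fun_mxP => f g; rewrite fun_mxE mxE; case: eqP => //= _.
  by case: eqP => // cf; case: nex; exists f.
move: ab; rewrite e0 mulmx0 mul0mx => /matrixP/(_ 0 0)/eqP.
by rewrite !mxE eq_sym oner_eq0.
Qed.

(** There are n + 1 partial sums, each at most n. The bound makes the climb along strict dominance
    terminate. *)
Lemma comp_weight_content (f : word n) : (comp_weight (content f) <= n.+1 * n)%N.
Proof.
apply: (@leq_trans (\sum_(m < n.+1) n)%N); last by rewrite sum_nat_const card_ord.
apply: leq_sum => m _; rewrite psum_content -[X in (_ <= X)%N]card_ord -sum1_card.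
by apply: leq_sum => x _; case: (_ < _)%N.
Qed.

Lemma content_shape (f : word n) :
    (forall i j : 'I_n, (i < j)%N -> (content f j <= content f i)%N) ->
  exists lam : intpart n, part_content lam = content f.
Proof.
move=> dec; have lt i : (content f i < n.+1)%N.
  rewrite ltnS contentE -[X in (_ <= X)%N]card_ord -sum1_card.
  by apply: leq_sum => x _; case: (_ == _).
pose l : {ffun 'I_n -> 'I_n.+1} := [ffun i => Ordinal (lt i)].
have lE i : l i = content f i :> nat by rewrite ffunE.
have lP : is_intpart l.
  apply/andP; split.
    apply/forallP=> i; apply/forallP=> j; apply/implyP; rewrite !lE.
    rewrite leq_eqVlt => /orP[/eqP/val_inj -> // |]; exact: dec.
  under eq_bigr => i _ do rewrite lE contentE.
  rewrite exchange_big /= -[X in _ == X]card_ord -sum1_card; apply/eqP.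
  apply: eq_bigr => x _; rewrite (bigD1 (f x)) //= eqxx big1 // => i ni.
  by rewrite eq_sym (negPf ni).
by exists (IntPart lP); apply/ffunP=> i; rewrite [LHS]ffunE /= lE.
Qed.

Lemma occurs_young m (X : reprS m) k : mx_indecomposable X -> occurs X k ->
  exists2 lam, comp_dom (part_content lam) k & mx_rsim X (young_module K lam).
Proof.
move=> indX; have locX := indecomposable_local indX.
have [d] := ubnP (n.+1 * n - comp_weight k); elim: d k => // d IHd k.
rewrite ltnS => ltd occX.
have up : (exists2 l, comp_sdom l k & occurs X l) ->
    exists2 lam, comp_dom (part_content lam) k & mx_rsim X (young_module K lam).
  move=> [l [dlk lt] occl].
  have ltd' : (n.+1 * n - comp_weight l < d)%N.
    apply: leq_trans ltd; apply: ltn_sub2l => //.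
    have [f cf] := occurs_content (proj1 locX) occl.
    by apply: leq_trans lt _; rewrite -cf comp_weight_content.
  have [lam dl sim] := IHd l ltd' occl.
  by exists lam => //; apply: comp_dom_trans dl dlk.
have [f cf] := occurs_content (proj1 locX) occX.
have [/forallP dec | ] := boolP [forall i : 'I_n, forall j : 'I_n,
    (i < j)%N ==> (content f j <= content f i)%N].
  have [|lam sh] := @content_shape f.
    by move=> i j; have /forallP/(_ j)/implyP := dec i.
  rewrite cf in sh; rewrite -sh in occX up *.
  have [sim | ] := occurs_cases indX occX; last exact: up.
  by exists lam; [exact: comp_dom_refl | apply/mx_rsim_sym/sim/young_moduleP].
(* The content is out of order at i < j, so its projector already lies in the ideal of strictly
   larger contents. *)
rewrite negb_forall => /existsP[i]; rewrite negb_forall => /existsP[j].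
rewrite negb_imply -ltnNge cf => /andP[ltij ltk]; apply: up.
have [a [b [ha hb ab]]] := occX.
apply: (above_occurs locX (above_swap K ltij ltk) ha hb).
by rewrite ab unitmx1.
Qed.

Lemma tabloid_summand_young m (X : reprS m) lam : mx_indecomposable X ->
    is_summand X (rM lam) ->
  exists2 lam', dominates lam' lam & mx_rsim X (young_module K lam').
Proof.
move=> indX /summand_occurs/(_ (tabloid_occurs lam)) occX.
by have [lam' /dominatesP] := occurs_young indX occX; exists lam'.
Qed.

(** The content of mu occurs in its Young module, and every content occurring in the Young module of
    lam is dominated by lam; by symmetry, each partition dominates the other. *)
Lemma young_module_inj lam mu :
  mx_rsim (young_module K lam) (young_module K mu) -> lam = mu.
Proof.
have dom_sim (l1 l2 : intpart n) :
    mx_rsim (young_module K l1) (young_module K l2) -> dominates l1 l2.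
  move=> sim; apply/dominatesP; apply: (young_split_dom (young_moduleP l1)).
  apply: summand_occurs (rsim_summand sim) _.
  exact: young_split_occurs (young_moduleP l2).
by move=> sim; apply: dominates_anti; apply: dom_sim => //; apply: mx_rsim_sym.
Qed.

Lemma young_summand lam : is_summand (young_module K lam) (rM lam).
Proof.
have [U [modU [sumU _ _ simY]]] := young_module_def lam.
have [A [B [hA hB AB _]]] := submod_split modU sumU.
by apply: summand_trans (rsim_summand simY) _; exists A, B.
Qed.

(** Two complementary copies would give projections with product 0, while each acts on the
    polytabloid by a nonzero scalar. *)
Lemma young_multiplicity_lt2 lam (Z : representation K [set: 'S_n]%G) :
  mx_rsim (rM lam) (dadd_grepr (young_module K lam) Z) ->
  ~ is_summand (young_module K lam) Z.
Proof.
set Y := young_module K lam; set v := polytabloid K (canonical_tableau lam).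
move=> /rsimP[P [Q [hP hQ PQ QP]]] [C [D [hC hD CD]]].
have youngY := young_moduleP lam; have [indY _] := youngY.
have [v0 eigv] := tabloid_eigenvector lam.
have hi := @mxhom_tabloid_to_word K n lam; have hj := @mxhom_word_to_tabloid K n lam.
have ij := tabloid_to_wordK K lam.
(* A copy of Y on which the eigenvalue of its projection vanishes would occur *)
(* in a permutation module strictly above lam.                                *)
have copy_neq0 A B : mxhom Y (rM lam) A -> mxhom (rM lam) Y B -> A *m B = 1%:M ->
    v *m B *m A != 0.
  move=> hA hB AB; apply/eqP=> vBA.
  have [c [abc e]] := specht_gen_eigen lam (mxhomM (mxhomM hj hB) (mxhomM hA hi)).
  have c0 : c = 0.
    apply/eqP; move: e; rewrite /specht_gen -/v !mulmxA -(mulmxA v) ij mulmx1 vBA.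
    move/esym/eqP; rewrite !mul0mx scaler_eq0 => /orP[//|].
    by have := specht_gen_neq0 lam; rewrite /specht_gen -/v => /negPf ->.
  rewrite c0 scale0r subr0 in abc.
  have [|l lt /(young_split_dom youngY)/(comp_sdomN lt)//] :=
    above_occurs (indecomposable_local indY) abc (mxhomM hA hi) (mxhomM hj hB).
  have ie := tabloid_to_word_proj K lam.
  rewrite -!mulmxA (mulmxA _ (wproj K _)) ie !mulmxA -(mulmxA A) ij mulmx1 AB mul1mx.
  by rewrite -(mulmxA A) ie -(mulmxA A) ij mulmx1 AB unitmx1.
pose A1 := row_mx 1%:M 0 *m Q; pose B1 := P *m col_mx 1%:M 0.
pose A2 := row_mx 0 C *m Q; pose B2 := P *m col_mx 0 D.
have hA1 : mxhom Y (rM lam) A1.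
  by apply: mxhomM hQ; apply/mxhom_row; split; [apply: mxhom1 | apply: mxhom0].
have hA2 : mxhom Y (rM lam) A2.
  by apply: mxhomM hQ; apply/mxhom_row; split; [apply: mxhom0 | apply: hC].
have hB1 : mxhom (rM lam) Y B1.
  by apply: mxhomM hP _; apply/mxhom_col; split; [apply: mxhom1 | apply: mxhom0].
have hB2 : mxhom (rM lam) Y B2.
  by apply: mxhomM hP _; apply/mxhom_col; split; [apply: mxhom0 | apply: hD].
have QPK k l (X1 : 'M_(k, _)) (X2 : 'M_(_, l)) : X1 *m Q *m (P *m X2) = X1 *m X2.
  by rewrite !mulmxA -(mulmxA X1) QP mulmx1.
have AB1 : A1 *m B1 = 1%:M by rewrite QPK mul_row_col mulmx1 mulmx0 addr0.
have AB2 : A2 *m B2 = 1%:M by rewrite QPK mul_row_col mul0mx add0r.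
have AB12 : A1 *m B2 = 0 by rewrite QPK mul_row_col mul0mx mulmx0 addr0.
clearbody A1 B1 A2 B2.
have [c1 e1] := eigv _ (mxhomM hB1 hA1).
have := copy_neq0 _ _ hA2 hB2 AB2.
have : v *m (B1 *m A1) *m (B2 *m A2) = 0.
  by rewrite !mulmxA -(mulmxA _ A1) AB12 mulmx0 mul0mx.
rewrite e1 -scalemxAl => /eqP; rewrite scaler_eq0 !mulmxA => /orP[/eqP c0 | -> //].
by have := copy_neq0 _ _ hA1 hB1 AB1; rewrite -mulmxA e1 c0 scale0r eqxx.
Qed.

Lemma young_count lam s : is_decomposition (rM lam) s ->
  count (fun r : representation K [set: 'S_n]%G =>
    boolp.asbool (mx_rsim r (young_module K lam))) s = 1%N.
Proof.
case/is_decompositionP=> ind_s sim_s.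
set Y := young_module K lam; have [indY _] := young_moduleP lam.
have locY := indecomposable_local indY.
have := summand_trans (young_summand lam) (rsim_summand sim_s).
move=> /(summand_dsum locY)[i lti sumY].
have simY := summand_local_rsim locY (ind_s i lti) sumY.
have [s1 [s2 def_s]] := split_nth grepr0 lti; move: (nth _ _ _) simY def_s => y simY def_s.
rewrite {}def_s in ind_s sim_s *; rewrite count_cat /=.
rewrite (boolp.asboolT (mx_rsim_sym simY)) addnCA -count_cat -[RHS]addn0.
congr (_ + _)%N; apply/eqP; rewrite -leqn0 leqNgt -has_count; apply/negP=> has_Y.
apply: (@young_multiplicity_lt2 lam (\big[dadd_grepr/grepr0]_(r <- s1 ++ s2) r)).
  apply: mx_rsim_trans sim_s _; apply: mx_rsim_trans (rsim_dsum_mid _ _ _) _.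
  exact: rsim_dadd (mx_rsim_sym simY) (mx_rsim_refl _).
move: has_Y => /(has_nthP grepr0)[j ltj /boolp.asboolP simj].
apply: summand_trans (rsim_summand (mx_rsim_sym simj)) _.
exact: nth_summand_dsum.
Qed.

End YoungModuleTheory.

(** * Collecting isomorphic summands into multiplicities *)

Section Collect.

Variables (K : fieldType) (gT : finGroupType) (G : {group gT}).
Local Notation repG := (representation K G).
Local Notation dsum s := (\big[dadd_grepr/grepr0]_(r <- s) r).
Local Notation simb r r' := (boolp.asbool (mx_rsim r r')).

Lemma rsim_big_grepr0 (I : Type) (s : seq I) (P : pred I) (F : I -> repG) :
  (forall i, P i -> mx_rsim (F i) grepr0) ->
  mx_rsim (\big[dadd_grepr/grepr0]_(i <- s | P i) F i) grepr0.
Proof.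
move=> F0; elim: s => [|i s IHs]; first by rewrite big_nil; apply: mx_rsim_refl.
rewrite big_cons; case: ifP => // /F0 Fi0.
exact: mx_rsim_trans (rsim_dadd Fi0 IHs) (rsim_dadd0 _).
Qed.

Lemma rsim_dsum_collect (I : finType) (P : pred I) (Y : I -> repG) (s : seq repG) :
    (forall i j, mx_rsim (Y i) (Y j) -> i = j) ->
    all_rep (fun r => exists2 i, P i & mx_rsim r (Y i)) s ->
  mx_rsim (dsum s) (\big[dadd_grepr/grepr0]_(i | P i)
    muln_grepr (Y i) (count (fun r : repG => simb r (Y i)) s)).
Proof.
move=> injY; elim: s => [|r s IHs] simY.
  rewrite big_nil; apply/mx_rsim_sym/rsim_big_grepr0 => i _.
  by rewrite /muln_grepr big_ord0; apply: mx_rsim_refl.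
have /all_rep_cons[[i Pi simr] /IHs{}IHs] := simY.
rewrite big_cons; apply: mx_rsim_trans (rsim_dadd simr IHs) _; apply: mx_rsim_sym.
(* Direct sums commute only up to isomorphism, so the index i is isolated by splitting the list of
   indices at i and moving its term to the front. *)
rewrite -!(big_filter _ P).
have : i \in [seq j <- index_enum I | P j] by rewrite mem_filter Pi mem_index_enum.
have : uniq [seq j <- index_enum I | P j] by rewrite filter_uniq // index_enum_uniq.
move: [seq _ <- _ | _] => e uniq_e mem_e; case/splitPr: mem_e uniq_e => e1 e2 uniq_e.
rewrite -(big_map _ xpredT id) -[X in dadd_grepr _ X](big_map _ xpredT id) !map_cat /=.
apply: mx_rsim_trans (rsim_dsum_mid _ _ _) _.
apply: mx_rsim_trans (rsim_dadd (mx_rsim_refl _) (mx_rsim_sym (rsim_dsum_mid _ _ _))).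
rewrite (boolp.asboolT simr) /muln_grepr big_ord_recl.
apply: mx_rsim_trans (mx_rsim_sym (rsim_daddA _ _ _)) _.
apply: rsim_dadd (mx_rsim_refl _) (rsim_dadd (mx_rsim_refl _) _).
rewrite -!map_cat !big_map.
have ni j : j \in e1 ++ e2 -> j != i.
  move: uniq_e; rewrite -cat1s uniq_catCA cat1s /= => /andP[ni _].
  by apply: contraTneq => ->.
apply: rsim_big_dadd => j /ni nji; rewrite boolp.asboolF ?add0n.
  exact: mx_rsim_refl.
by move=> simrj; case/eqP: nji; apply: injY; apply: mx_rsim_trans simr; apply: mx_rsim_sym.
Qed.

End Collect.

Lemma nth_allpairs (A B C : Type) (x : A) (y : B) (z : C) (f : A -> B -> C) s t k :
  (k < size [seq f u v | u <- s, v <- t])%N -> exists i j,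
  [/\ (i < size s)%N, (j < size t)%N
    & nth z [seq f u v | u <- s, v <- t] k = f (nth x s i) (nth y t j)].
Proof.
elim: s k => [|u s IHs] k //=; rewrite size_cat nth_cat size_map => ltk.
have [ltkt | letk] := ltnP k (size t).
  by exists 0%N, k; rewrite (nth_map y).
have [|i [j [lti ltj ->]]] := IHs (k - size t)%N.
  by rewrite -(ltn_add2l (size t)) subnKC.
by exists i.+1, j.
Qed.

Lemma count_allpairs (A B C : Type) (x : A) (y : B) (f : A -> B -> C)
    (p : pred C) (a : pred A) (b : pred B) s t :
    (forall i j, (i < size s)%N -> (j < size t)%N ->
       p (f (nth x s i) (nth y t j)) = a (nth x s i) && b (nth y t j)) ->
  count p [seq f u v | u <- s, v <- t] = (count a s * count b t)%N.
Proof.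
elim: s => [|u s IHs] pf //=; rewrite count_cat mulnDl IHs => [|i j lti ltj].
  congr (_ + _)%N; rewrite count_map.
  have {}pf j : (j < size t)%N -> p (f u (nth y t j)) = a u && b (nth y t j).
    exact: (pf 0%N).
  elim: t {IHs} pf => [|v t IHt] pf; first by rewrite muln0.
  rewrite /= (pf 0%N) // IHt => [|j ltj]; last exact: (pf j.+1).
  by rewrite mulnDr mulnb.
exact: (pf i.+1).
Qed.

(** * Young modules of a product of two symmetric groups *)

Section YoungModules2.

Variables (K : fieldType) (a b : nat).
Local Notation Y := (young_module K).
Local Notation Y2 := (@young_module2 K a b).
Local Notation M2 := (@tabloid_module2 K a b).
Local Notation rep2 := (representation K (setX_group [set: 'S_a] [set: 'S_b])).
Local Notation simb r r' := (boolp.asbool (mx_rsim r r')).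

Lemma young_module_indecomposable n (lam : intpart n) : mx_indecomposable (Y lam).
Proof. by case: (young_moduleP K lam). Qed.

Lemma young_module2_indecomposable l : mx_indecomposable (Y2 l).
Proof.
have [u eigu] := young_split_eigenvector (young_moduleP K l.1).
exact: tensor_indecomposable (young_module_indecomposable _) eigu
  (young_module_indecomposable _).
Qed.

Lemma rsim_tensor_young (X : representation K [set: 'S_a]%G)
    (X' : representation K [set: 'S_b]%G) l :
    mx_indecomposable X -> mx_indecomposable X' ->
  mx_rsim (rep_tensor X X') (Y2 l) <-> mx_rsim X (Y l.1) /\ mx_rsim X' (Y l.2).
Proof.
move=> indX indX'; split=> [sim | [sim sim']]; last exact: rsim_tensor.
split.
  apply: rsim_tensorl (proj1 indX') (indecomposable_local indX) _ sim.
  exact: young_module_indecomposable.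
apply: rsim_tensorr (proj1 indX) (indecomposable_local indX') _ sim.
exact: young_module_indecomposable.
Qed.

Lemma young_module2_inj l l' : mx_rsim (Y2 l) (Y2 l') -> l = l'.
Proof.
case/rsim_tensor_young; try exact: young_module_indecomposable.
case: l l' => [l1 l2] [l1' l2'] /= /young_module_inj -> /young_module_inj -> //.
Qed.

(** The pairwise tensor products of two decompositions into Young modules are again indecomposable,
    and the leading multiplicity is the product of two multiplicities equal to 1. *)
Lemma tabloid_module2_decomposition (l : intpart a * intpart b) :
  exists s, [/\ is_decomposition (M2 l) s,
    all_rep (fun r => exists2 l', dominates2 l' l & mx_rsim r (Y2 l')) s
  & count (fun r : rep2 => simb r (Y2 l)) s = 1%N].
Proof.
have [s dec_s] := decomposition_exists (tabloid_module K l.1).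
have [t dec_t] := decomposition_exists (tabloid_module K l.2).
have /is_decompositionP[ind_s sim_s] := dec_s.
have /is_decompositionP[ind_t sim_t] := dec_t.
have young_s n (lam : intpart n) e : is_decomposition (tabloid_module K lam) e ->
    all_rep (fun r => exists2 lam', dominates lam' lam & mx_rsim r (Y lam')) e.
  case/is_decompositionP=> ind_e sim_e i lti; apply: tabloid_summand_young.
    exact: ind_e.
  apply: summand_trans (nth_summand_dsum lti) _.
  exact/rsim_summand/mx_rsim_sym.
pose st := [seq rep_tensor X X' | X <- s, X' <- t].
have young_st : all_rep (fun r => exists2 l', dominates2 l' l & mx_rsim r (Y2 l')) st.
  move=> k ltk; have [i [j [lti ltj ->]]] := nth_allpairs grepr0 grepr0 grepr0 ltk.
  have [l1 d1 sim1] := young_s _ _ _ dec_s i lti.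
  have [l2 d2 sim2] := young_s _ _ _ dec_t j ltj.
  exists (l1, l2); first by rewrite /dominates2 d1 d2.
  exact: rsim_tensor.
exists st; split=> //.
  apply/is_decompositionP; split=> [k ltk|].
    have [l' _ sim] := young_st k ltk.
    exact: rsim_indecomposable (mx_rsim_sym sim) (young_module2_indecomposable l').
  exact: mx_rsim_trans (rsim_tensor sim_s sim_t) (rsim_tensor_dsum s t).
rewrite (@count_allpairs _ _ _ grepr0 grepr0 _ _
  (fun r : representation K [set: 'S_a]%G => simb r (Y l.1))
  (fun r : representation K [set: 'S_b]%G => simb r (Y l.2))) => [|i j lti ltj].
  by rewrite !young_count.
have simP := rsim_tensor_young l (ind_s i lti) (ind_t j ltj).
apply/boolp.asboolP/andP=> [/simP[sim1 sim2] | [/boolp.asboolP s1 /boolp.asboolP s2]].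
  by split; apply/boolp.asboolP.
exact/simP.
Qed.

End YoungModules2.

Theorem theorem3p7 (K : fieldType) (p : nat) (charK : has_char K p)
    (a b : nat) (lam : intpart a) (mu : intpart b) :
  exists mult : intpart a * intpart b -> nat,
    [/\ [/\ forall l : intpart a * intpart b,
              mx_indecomposable (young_module2 K l),
            exists s, is_decomposition (tabloid_module2 K (lam, mu)) s
          & forall s, is_decomposition (tabloid_module2 K (lam, mu)) s ->
            forall i : 'I_(size s), exists (lam' : intpart a) (mu' : intpart b),
              [/\ dominates lam' lam, dominates mu' mu
                & mx_rsim (nth grepr0 s i) (young_module2 K (lam', mu'))]],
        (forall l : intpart a * intpart b,
           is_multiplicity (tabloid_module2 K (lam, mu))
                           (young_module2 K l) (mult l))
        /\ mult (lam, mu) = 1%N,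
        forall (lam1 lam2 : intpart a) (mu1 mu2 : intpart b),
          mx_rsim (young_module2 K (lam2, mu2)) (young_module2 K (lam1, mu1))
          <-> lam2 = lam1 /\ mu2 = mu1
      & mx_rsim (tabloid_module2 K (lam, mu))
          (dadd_grepr (young_module2 K (lam, mu))
             (\big[dadd_grepr/grepr0]_(l : intpart a * intpart b |
                  dominates2 l (lam, mu) && (l != (lam, mu)))
                muln_grepr (young_module2 K l) (mult l)))].
Proof.
have [s [dec_s young_s count_s]] := tabloid_module2_decomposition K (lam, mu).
have /is_decompositionP[ind_s sim_s] := dec_s.
pose simY l (r : representation K (setX_group [set: 'S_a] [set: 'S_b])) :=
  boolp.asbool (mx_rsim r (young_module2 K l)).
(* The multiplicities are read off one decomposition; Krull-Schmidt makes them independent of this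
   choice. *)
exists (fun l => count (simY l) s); split.
- split=> [l||t]; [exact: young_module2_indecomposable | by exists s |].
  case/is_decompositionP=> ind_t sim_t i.
  have loc_i := indecomposable_local (ind_t i (ltn_ord i)).
  have := summand_trans (nth_summand_dsum (ltn_ord i)) (rsim_summand (mx_rsim_sym sim_t)).
  move/summand_trans/(_ (rsim_summand sim_s))/(summand_dsum loc_i)=> [k ltk sum_k].
  have [[l m] /andP[dl dm] sim_k] := young_s k ltk; exists l, m; split=> //.
  exact: mx_rsim_trans (summand_local_rsim loc_i (ind_s k ltk) sum_k) sim_k.
- split=> // l; split; first by exists s.
  move=> t /is_decompositionP[ind_t sim_t].
  apply: (Krull_Schmidt_count (P := simY l)) ind_t ind_s _.
    move=> r r' sim; apply/boolp.asboolP/boolp.asboolP => sim'.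
      exact: mx_rsim_trans (mx_rsim_sym sim) sim'.
    exact: mx_rsim_trans sim sim'.
  exact: mx_rsim_trans (mx_rsim_sym sim_t) sim_s.
- move=> lam1 lam2 mu1 mu2; split=> [/young_module2_inj[-> ->] // | [-> ->]].
  exact: mx_rsim_refl.
(* The single copy y of the leading Young module is split off; removing it leaves all other
   multiplicities unchanged, and no remaining summand has the label (lam, mu). *)
have : has (simY (lam, mu)) s by rewrite has_count count_s.
move=> /(has_nthP grepr0)[i lti /boolp.asboolP sim_i].
have [s1 [s2 def_s]] := split_nth grepr0 lti.
move: (nth _ _ _) sim_i def_s => y sim_y def_s.
have cnt l : count (simY l) s = (simY l y + count (simY l) (s1 ++ s2))%N.
  by rewrite def_s !count_cat /= addnCA.
have count0 : count (simY (lam, mu)) (s1 ++ s2) = 0%N.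
  by move: count_s; rewrite cnt /simY (boolp.asboolT sim_y) add1n => [[]].
have sim_mid : mx_rsim (tabloid_module2 K (lam, mu))
    (\big[dadd_grepr/grepr0]_(r <- s1 ++ y :: s2) r) by rewrite -def_s.
apply: mx_rsim_trans sim_mid _.
apply: mx_rsim_trans (rsim_dsum_mid _ _ _) _; apply: (rsim_dadd sim_y).
have -> : \big[dadd_grepr/grepr0]_(l | dominates2 l (lam, mu) && (l != (lam, mu)))
      muln_grepr (young_module2 K l) (count (simY l) s)
    = \big[dadd_grepr/grepr0]_(l | dominates2 l (lam, mu) && (l != (lam, mu)))
      muln_grepr (young_module2 K l) (count (simY l) (s1 ++ s2)).
  apply: eq_bigr => l /andP[_ nl]; rewrite cnt [simY l y]boolp.asboolF // => sim.
  case/eqP: nl; apply: (@young_module2_inj K).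
  exact: mx_rsim_trans (mx_rsim_sym sim) sim_y.
apply: rsim_dsum_collect => [|k ltk]; first exact: young_module2_inj.
have := young_s; rewrite [X in all_rep _ X]def_s => /all_rep_mid[_ young_s12].
have [l dl sim_k] := young_s12 k ltk; exists l => //; rewrite dl /=.
apply: contra_eqN count0 => /eqP el; rewrite -lt0n -has_count.
by apply/(has_nthP grepr0); exists k => //; apply/boolp.asboolP; rewrite -el.
Qed.
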